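(* Let $(\mathbb{Z},\boldsymbol{\preccurlyeq}_{321})$ be the random total order on $\mathbb{Z}$ constructed in the context, and let $\boldsymbol{\sigma}^\infty_{321}$ be a random infinite rooted permutation whose law $\mathcal{L}(\boldsymbol{\sigma}^\infty_{321})$ is the quenched Benjamini--Schramm limit of a sequence $(\boldsymbol{\sigma}^n)_{n\in\mathbb{Z}_{>0}}$ of uniform random permutations in $\mathrm{Av}^n(321)$. Then $$(\mathbb{Z},\boldsymbol{\preccurlyeq}_{321})\stackrel{(d)}{=}\boldsymbol{\sigma}^\infty_{321}.$$
   Context: All intervals $[a,b]$ are integer intervals. $\mathcal{S}^n$ is the set of permutations $\sigma=\sigma_1\cdots\sigma_n$ of $[n]=\{1,\dots,n\}$, and $|\sigma|=n$ is the size. $\mathrm{Av}^n(321)$ is the set of permutations in $\mathcal{S}^n$ having no decreasing subsequence of length $3$. Rooted permutations. A finite rooted permutation is a pair $(\sigma,i)$ with $\sigma\in\mathcal{S}^n$, $n\ge1$, $i\in[n]$. It is identified with the pair $(A_{\sigma,i},\preccurlyeq_{\sigma,i})$, where $A_{\sigma,i}=[-i+1,|\sigma|-i]$ and $\preccurlyeq_{\sigma,i}$ is the total order on it given by $\ell\preccurlyeq_{\sigma,i}j\iff\sigma_{\ell+i}\le\sigma_{j+i}$; this is a bijection between finite rooted permutations and total orders on finite integer intervals containing $0$. An infinite rooted permutation is a pair $(A,\preccurlyeq)$ with $A$ an infinite integer interval containing $0$ and $\preccurlyeq$ a total order on $A$. $\tilde{\mathcal{S}}_\bullet$ is the set of all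 finite and infinite rooted permutations. For $h\in\mathbb{Z}_{>0}$, $r_h(A,\preccurlyeq)=(A\cap[-h,h],\preccurlyeq)$. The local distance on $\tilde{\mathcal{S}}_\bullet$ is $d(x,y)=2^{-\sup\{h\in\mathbb{Z}_{>0}:\,r_h(x)=r_h(y)\}}$, with $\sup\emptyset=0$, $\sup\mathbb{Z}_{>0}=+\infty$, $2^{-\infty}=0$. Quenched convergence: for a permutation $\sigma$, let $\mu_\sigma$ be the law of $(\sigma,\boldsymbol{i})$ with $\boldsymbol{i}$ uniform in $[|\sigma|]$. A sequence $(\boldsymbol{\sigma}^n)$ of random permutations converges in the quenched Benjamini--Schramm sense to a probability measure $\mu$ on $\tilde{\mathcal{S}}_\bullet$ if the random measures $\mu_{\boldsymbol{\sigma}^n}$ converge in distribution to $\mu$ with respect to the weak topology on probability measures on $(\tilde{\mathcal{S}}_\bullet,d)$. (For uniform permutations in $\mathrm{Av}^n(321)$ such a deterministic limit exists and is the law of a random infinite rooted permutation.) Construction of $(\mathbb{Z},\boldsymbol{\preccurlyeq}_{321})$. Label each integer independently with ''$+$'' or ''$-$'', each with probability $\frac12$. Let $A^+$ (resp. $A^-$) be the set of integers with label ''$+$'' (resp. ''$-$''). For $x,y\in\mathbb{Z}$ distinct, set $x\boldsymbol{\preccurlyeq}_{321}y$ if either $x<y$ and $x,y\in A^-$, or $x<y$ and $x,y\in A^+$, or $x\in A^-$ and $y\in A^+$ (and $x\boldsymbol{\preccurlyeq}_{321}x$ always). *)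

(* Defs.v *)
From HB Require Import structures.
From mathcomp Require Import all_boot all_order all_algebra fingroup perm zify.
From mathcomp Require Import all_classical all_reals all_analysis.

Set Implicit Arguments.
Unset Strict Implicit.
Unset Printing Implicit Defensive.

Import Order.TTheory GRing.Theory Num.Theory.
Import numFieldNormedType.Exports.

Local Open Scope classical_set_scope.
Local Open Scope ring_scope.

(* A rooted permutation, finite or infinite, as a total order on an integer
   interval containing 0. The relation is false off the domain, so that Leibniz
   equality is equality of the pairs (A, <=). *)
Record rooted_perm := RootedPerm {
  rp_dom : set int;
  rp_le : rel int;
  rp_dom0 : rp_dom 0;
  rp_itv : is_interval rp_dom;
  rp_supp : forall x y, rp_le x y -> rp_dom x /\ rp_dom y;
  rp_refl : forall x, rp_dom x -> rp_le x x;
  rp_anti : forall x y, rp_le x y -> rp_le y x -> x = y;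
  rp_trans : forall x y z, rp_le x y -> rp_le y z -> rp_le x z;
  rp_total : forall x y, rp_dom x -> rp_dom y -> rp_le x y || rp_le y x }.

Lemma rooted_perm_eq (x y : rooted_perm) :
  rp_dom x = rp_dom y -> rp_le x = rp_le y -> x = y.
Proof.
case: x => A r ? ? ? ? ? ? ?; case: y => B s ? ? ? ? ? ? ? /= AB rs.
by subst B s; congr RootedPerm; exact: Prop_irrelevance.
Qed.

Section finite_rooted_perm.
Variables (n : nat) (s : 'S_n.+1) (i : 'I_n.+1).

(* Positions and values of s are indexed from 0, so that the interval
   [-i+1, |s|-i] reads [-i, n-i]. *)
Definition perm_dom : set int := [set l | 0 <= l + i%:Z <= n%:Z].

Definition perm_le : rel int := fun l j =>
  [&& 0 <= l + i%:Z <= n%:Z, 0 <= j + i%:Z <= n%:Z &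
      (s (inord (absz (l + i%:Z)%R)) <= s (inord (absz (j + i%:Z)%R)))%N].

Lemma perm_dom0 : perm_dom 0.
Proof. by rewrite /perm_dom /=; have := ltn_ord i; lia. Qed.

Lemma perm_itv : is_interval perm_dom.
Proof. by move=> x y; rewrite /perm_dom /= => ? ? z ?; lia. Qed.

Lemma perm_supp x y : perm_le x y -> perm_dom x /\ perm_dom y.
Proof. by case/and3P. Qed.

Lemma perm_refl x : perm_dom x -> perm_le x x.
Proof. by rewrite /perm_dom /perm_le /= => ->/=. Qed.

Lemma perm_anti x y : perm_le x y -> perm_le y x -> x = y.
Proof.
case/and3P=> hx hy xy /and3P[_ _ yx].
have /perm_inj/(congr1 val) /= :
    s (inord (absz (x + i%:Z)%R)) = s (inord (absz (y + i%:Z)%R)).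
  by apply/val_inj/eqP; rewrite eqn_leq; apply/andP.
by rewrite !inordK; lia.
Qed.

Lemma perm_trans x y z : perm_le x y -> perm_le y z -> perm_le x z.
Proof.
case/and3P=> hx _ xy /and3P[_ hz yz].
by apply/and3P; split=> //; exact: leq_trans yz.
Qed.

Lemma perm_total x y : perm_dom x -> perm_dom y -> perm_le x y || perm_le y x.
Proof. by rewrite /perm_dom /perm_le /= => -> -> /=; exact: leq_total. Qed.

Definition rp_of_perm : rooted_perm :=
  RootedPerm perm_dom0 perm_itv perm_supp perm_refl perm_anti perm_trans
    perm_total.

End finite_rooted_perm.

Section restriction.
Variables (h : nat) (x : rooted_perm).

Definition restr_dom : set int := [set a | rp_dom x a /\ `|a| <= h%:Z].

Definition restr_le : rel int := fun a b =>
  [&& `|a| <= h%:Z, `|b| <= h%:Z & rp_le x a b].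

Lemma restr_dom0 : restr_dom 0.
Proof. by split; [exact: rp_dom0|rewrite normr0]. Qed.

Lemma restr_itv : is_interval restr_dom.
Proof.
move=> a b [xa ha] [xb hb] c abc; split; first exact: rp_itv abc.
by move: ha hb abc; lia.
Qed.

Lemma restr_supp a b : restr_le a b -> restr_dom a /\ restr_dom b.
Proof. by case/and3P=> ha hb /rp_supp[]. Qed.

Lemma restr_refl a : restr_dom a -> restr_le a a.
Proof. by case=> xa ha; rewrite /restr_le ha rp_refl. Qed.

Lemma restr_anti a b : restr_le a b -> restr_le b a -> a = b.
Proof. by case/and3P=> _ _ ab /and3P[_ _]; exact: rp_anti. Qed.

Lemma restr_trans a b c : restr_le a b -> restr_le b c -> restr_le a c.
Proof.
case/and3P=> ha _ ab /and3P[_ hc bc].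
by apply/and3P; split=> //; exact: rp_trans bc.
Qed.

Lemma restr_total a b : restr_dom a -> restr_dom b ->
  restr_le a b || restr_le b a.
Proof. by case=> xa ha [xb hb]; rewrite /restr_le ha hb /=; exact: rp_total. Qed.

Definition rp_restr : rooted_perm :=
  RootedPerm restr_dom0 restr_itv restr_supp restr_refl restr_anti restr_trans
    restr_total.

End restriction.

Lemma rp_restrP h x y : rp_restr h x = rp_restr h y <->
  (forall a, `|a| <= h%:Z -> rp_dom x a <-> rp_dom y a) /\
  (forall a b, `|a| <= h%:Z -> `|b| <= h%:Z -> rp_le x a b = rp_le y a b).
Proof.
split=> [e|[dxy lxy]].
  split=> [a ha|a b ha hb].
    have : rp_dom (rp_restr h x) a <-> rp_dom (rp_restr h y) a by rewrite e.
    by rewrite /= /restr_dom /=; tauto.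
  have := congr1 (fun z => rp_le z a b) e.
  by rewrite /= /restr_le ha hb.
apply: rooted_perm_eq => /=.
  by apply/seteqP; split=> a [xa ha]; split=> //; apply/dxy.
apply/funext => a; apply/funext => b; rewrite /restr_le.
by case: (boolP (`|a| <= _)) => //= ha; case: (boolP (`|b| <= _)) => //= hb; rewrite lxy.
Qed.

Lemma rp_restr_le (h k : nat) x y : (k <= h)%N ->
  rp_restr h x = rp_restr h y -> rp_restr k x = rp_restr k y.
Proof.
move=> kh /rp_restrP[dxy lxy]; apply/rp_restrP.
by split=> [a ha|a b ha hb]; [apply: dxy|apply: lxy]; lia.
Qed.

Section local_distance.
Variable R : realType.
Implicit Types x y z : rooted_perm.

Definition agree_radius x y : \bar R :=
  ereal_sup [set h%:R%:E | h in
    [set h : nat | (0 < h)%N /\ rp_restr h x = rp_restr h y]].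

(* 2 ^ (- s); the value -oo is the supremum of the empty set, which the
   local distance takes to be 0. *)
Definition pow2N (s : \bar R) : R :=
  match s with
  | r%:E => 2 `^ (- r)
  | +oo%E => 0
  | -oo%E => 1
  end.

Definition local_dist x y : R := pow2N (agree_radius x y).

Lemma agree_radius_ge (h : nat) x y : (0 < h)%N ->
  rp_restr h x = rp_restr h y -> (h%:R%:E <= agree_radius x y)%E.
Proof. by move=> h0 xy; apply: ereal_sup_ubound; exists h. Qed.

Lemma agree_radius_le x y (b : \bar R) :
  (forall h : nat, (0 < h)%N -> rp_restr h x = rp_restr h y -> (h%:R%:E <= b)%E) ->
  (agree_radius x y <= b)%E.
Proof. by move=> H; apply: ge_ereal_sup => _ [h [h0 xy] <-]; exact: H. Qed.

Lemma agree_radius_cases x y :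
  agree_radius x y = -oo%E \/ (0 <= agree_radius x y)%E.
Proof.
have [H|/existsNP[h /not_implyP[h0 /contrapT xy]]] := pselect (forall h : nat,
    (0 < h)%N -> rp_restr h x <> rp_restr h y); last first.
  right; apply: le_trans (agree_radius_ge h0 xy).
  by rewrite lee_fin.
left; apply/eqP; rewrite -leeNy_eq; apply: agree_radius_le => h h0 xy.
by have := H h h0 xy.
Qed.

Lemma agree_radius_sym x y : agree_radius x y = agree_radius y x.
Proof.
by apply/eqP; rewrite eq_le !agree_radius_le// => h h0 e;
  apply: agree_radius_ge.
Qed.

Lemma agree_radius_xx x : agree_radius x x = +oo%E.
Proof.
apply/eqyP => A A0; apply: (@le_trans _ _ (Num.truncn A).+1%:R%:E).
  by rewrite lee_fin ltW// truncnS_gt.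
exact: agree_radius_ge.
Qed.

(* ultrametric inequality, on the exponents *)
Lemma agree_radius_min y x z : (agree_radius x y <= agree_radius y z)%E ->
  (agree_radius x y <= agree_radius x z)%E.
Proof.
move=> xyz; apply: agree_radius_le => h h0 xy.
have [yz|yz] := pselect (rp_restr h y = rp_restr h z).
  by apply: agree_radius_ge => //; rewrite xy.
have : (agree_radius y z <= h.-1%:R%:E)%E.
  apply: agree_radius_le => k k0 yzk; rewrite lee_fin ler_nat.
  rewrite leqNgt; apply/negP => hk; apply: yz; apply: rp_restr_le yzk.
  by lia.
move=> /(le_trans xyz) /(le_trans (agree_radius_ge h0 xy)).
by rewrite lee_fin ler_nat; lia.
Qed.

Lemma pow2N_ge0 s : 0 <= pow2N s.
Proof. by case: s => [r| |] //=; exact: powR_ge0. Qed.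

Lemma pow2N_le (s t : \bar R) : t = -oo%E \/ (0 <= t)%E -> (s <= t)%E ->
  pow2N t <= pow2N s.
Proof.
case: t => [t| |] t0 st; last 2 first.
- exact: pow2N_ge0.
- by move: st; rewrite leeNy_eq => /eqP ->.
have {}t0 : 0 <= t by case: t0.
case: s st => [s| |] //= st.
  by apply: ler_powR; rewrite ?ler1n// lerN2.
by rewrite -[leRHS](powRr0 2); apply: ler_powR; rewrite ?ler1n// oppr_le0.
Qed.

Lemma local_dist_le (h : nat) x y : (0 < h)%N ->
  rp_restr h x = rp_restr h y -> local_dist x y <= 2 `^ (- h%:R).
Proof.
move=> h0 xy; apply: (@pow2N_le h%:R%:E); first exact: agree_radius_cases.
exact: agree_radius_ge.
Qed.

Lemma local_distxx x : local_dist x x = 0.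
Proof. by rewrite /local_dist agree_radius_xx. Qed.

Lemma local_dist_sym x y : local_dist x y = local_dist y x.
Proof. by rewrite /local_dist agree_radius_sym. Qed.

Lemma local_dist_positivity x y : local_dist x y = 0 -> x = y.
Proof.
move=> xy0.
have ry : agree_radius x y = +oo%E.
  move: xy0; rewrite /local_dist; case: (agree_radius x y) => [r| |] //= /eqP.
    by rewrite gt_eqF// powR_gt0.
  by rewrite oner_eq0.
have xy (h : nat) : rp_restr h x = rp_restr h y.
  apply: contrapT => nxy.
  have : (agree_radius x y <= h%:R%:E)%E.
    apply: agree_radius_le => k k0 xyk; rewrite lee_fin ler_nat leqNgt.
    by apply/negP => hk; apply: nxy; apply: rp_restr_le xyk; exact: ltnW.
  by rewrite ry.
apply: rooted_perm_eq.
  apply/seteqP; split=> a.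
    by have /rp_restrP[/(_ a) + _] := xy (absz a); move=> []//; lia.
  by have /rp_restrP[/(_ a) + _] := xy (absz a); move=> []//; lia.
apply/funext => a; apply/funext => b.
by have /rp_restrP[_ ->] := xy (maxn (absz a) (absz b)); lia.
Qed.

Lemma local_dist_triangle y x z :
  local_dist x z <= local_dist x y + local_dist y z.
Proof.
have [xyz|/ltW yzx] := leP (agree_radius x y) (agree_radius y z).
  apply: (@le_trans _ _ (local_dist x y)); last by rewrite lerDl pow2N_ge0.
  by apply: pow2N_le; [exact: agree_radius_cases|exact: agree_radius_min xyz].
apply: (@le_trans _ _ (local_dist y z)); last by rewrite lerDr pow2N_ge0.
apply: pow2N_le; first exact: agree_radius_cases.
rewrite (agree_radius_sym y z) (agree_radius_sym x z).
by apply: agree_radius_min; rewrite (agree_radius_sym y x) (agree_radius_sym z y).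
Qed.

End local_distance.

(* The space of rooted permutations with the local distance; the parameter only
   records where the distance takes its values. *)
Definition rooted_space (R : realType) : Type := rooted_perm.

HB.instance Definition _ (R : realType) := gen_eqMixin (rooted_space R).
HB.instance Definition _ (R : realType) := gen_choiceMixin (rooted_space R).
HB.instance Definition _ (R : realType) := isPointed.Build (rooted_space R)
  (rp_of_perm (1%g : 'S_1) ord0).
HB.instance Definition _ (R : realType) := isMetric.Build R (rooted_space R)
  (@local_distxx R) (@local_dist_positivity R) (@local_dist_sym R)
  (@local_dist_triangle R).
HB.instance Definition _ (R : realType) := Measurable.copy (rooted_space R)
  (g_sigma_algebraType (@open (rooted_space R))).

Section weak_topology.
Variable R : realType.
Local Notation S := (rooted_space R).

Definition pmeasure : Type := probability S R.

HB.instance Definition _ := gen_eqMixin pmeasure.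
HB.instance Definition _ := gen_choiceMixin pmeasure.

Definition test_fun : Type :=
  {f : S -> R | continuous f /\ exists M, forall x, `|f x| <= M}.

HB.instance Definition _ := gen_eqMixin test_fun.
HB.instance Definition _ := gen_choiceMixin test_fun.

Definition test_integrals (mu : pmeasure) : {ptws test_fun -> R} :=
  fun f => Rintegral (mu : probability S R) setT (sval f).

(* weak topology: the coarsest one for which mu |-> \int f dmu is continuous
   for every bounded continuous f *)
HB.instance Definition _ :=
  Topological.copy pmeasure (initial_topology test_integrals).

End weak_topology.

Section root_law.
Variables (R : realType) (n : nat) (s : 'S_n.+1).

Definition root_law : set (rooted_space R) -> \bar R :=
  mscale (n.+1%:R^-1)%:nng
    (msum (fun k => \d_(rp_of_perm s (inord k) : rooted_space R)) n.+1).

HB.instance Definition _ := Measure.on root_law.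

Lemma root_lawT : root_law setT = 1%E.
Proof.
rewrite /root_law /mscale /msum.
rewrite [X in (_ * X)%E](_ : _ = \sum_(k < n.+1) (1%R)%:E)%E; last first.
  by apply: eq_bigr => k _; rewrite /= diracT.
by rewrite sumEFin -EFinM sumr_const card_ord /= mulVf// pnatr_eq0.
Qed.

HB.instance Definition _ := Measure_isProbability.Build _ _ _ root_law root_lawT.

Definition mu_perm : pmeasure R := (root_law : probability (rooted_space R) R).

End root_law.

Arguments mu_perm R {n} s.

(* A sequence of random permutations of sizes 1, 2, ...: the n-th one has size
   n.+1. Convergence in distribution of the random measures to the constant mu is
   tested on bounded functions F that are continuous for the weak topology. *)
Definition quenched_BS_cvg (R : realType) (d : nat -> measure_display)
    (Omega : forall n, measurableType (d n)) (P : forall n, probability (Omega n) R)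
    (sigma : forall n, Omega n -> 'S_n.+1) (mu : pmeasure R) : Prop :=
  forall F : pmeasure R -> R, continuous F -> (exists M, forall nu, `|F nu| <= M) ->
    ('E_(P n)[fun w => F (mu_perm R (sigma n w))])%E @[n --> \oo] --> (F mu)%:E.

Definition Av321 (n : nat) : {set 'S_n} :=
  [set s : 'S_n | [forall i : 'I_n, forall j : 'I_n, forall k : 'I_n,
     (i < j < k)%N ==> ~~ (s k < s j < s i)%N]]%SET.

Definition uniform_random_perm (R : realType) (d : measure_display)
    (Omega : measurableType d) (P : probability Omega R) (n : nat)
    (A : {set 'S_n}) (sigma : Omega -> 'S_n) : Prop :=
  forall s : 'S_n, measurable (sigma @^-1` [set s]) /\
    P (sigma @^-1` [set s]) = (if s \in A then #|A|%:R^-1 else 0)%:E.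

Definition mutually_independent (R : realType) (d d' : measure_display)
    (Omega : measurableType d) (T : measurableType d') (P : probability Omega R)
    (I : eqType) (X : I -> {RV P >-> T}) : Prop :=
  forall (s : seq I) (B : I -> set T), uniq s ->
    (forall i, i \in s -> measurable (B i)) ->
    P (\bigcap_(i in [set` s]) X i @^-1` B i) =
    (\prod_(i <- s) P (X i @^-1` B i))%E.

(* labels: true is "+", false is "-" *)
Definition iid_fair_labels (R : realType) (d : measure_display)
    (Omega : measurableType d) (P : probability Omega R)
    (L : int -> {RV P >-> bool}) : Prop :=
  mutually_independent L /\
  forall (x : int) (b : bool), P (L x @^-1` [set b]) = (2^-1)%:E.

Section order321.
Variable L : int -> bool.

Definition le321 : rel int := fun x y =>
  [|| x == y, [&& x < y, ~~ L x & ~~ L y], [&& x < y, L x & L y] |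
      ~~ L x && L y].

Lemma le321_itv : is_interval [set: int]. Proof. by []. Qed.

Lemma le321_supp x y : le321 x y -> [set: int] x /\ [set: int] y.
Proof. by []. Qed.

Lemma le321E x y : le321 x y = if L x == L y then x <= y else L y.
Proof.
rewrite /le321 le_eqVlt; have [->|_] := eqVneq x y; first by rewrite eqxx.
by case: (L x); case: (L y); rewrite /= ?andbT ?andbF ?orbF.
Qed.

Lemma le321_refl x : [set: int] x -> le321 x x.
Proof. by rewrite /le321 eqxx. Qed.

Lemma le321_anti x y : le321 x y -> le321 y x -> x = y.
Proof.
rewrite !le321E eq_sym; case: (L x); case: (L y) => //= xy yx;
by apply/eqP; rewrite eq_le xy.
Qed.

Lemma le321_trans x y z : le321 x y -> le321 y z -> le321 x z.
Proof.
rewrite !le321E; case: (L x); case: (L y); case: (L z) => //=;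
exact: le_trans.
Qed.

Lemma le321_total x y : [set: int] x -> [set: int] y -> le321 x y || le321 y x.
Proof.
move=> _ _; rewrite !le321E; case: (L x); case: (L y) => //=;
exact: le_total.
Qed.

Definition rp321 : rooted_perm :=
  @RootedPerm [set: int] le321 I le321_itv le321_supp le321_refl le321_anti
    le321_trans le321_total.

End order321.

Section random_order321.
Variables (R : realType) (d : measure_display) (Omega : measurableType d).
Variable (L : int -> {mfun Omega >-> bool}).

Definition random_order321 (w : Omega) : rooted_space R := rp321 (fun x => L x w).

Let window (h : nat) (l : int -> bool) : seq bool :=
  mkseq (fun k => l (k%:Z - h%:Z)) h.*2.+1.

Lemma window_agree (h : nat) (l l' : int -> bool) :
  window h l = window h l' -> rp_restr h (rp321 l) = rp_restr h (rp321 l').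
Proof.
move=> e; have ll a : `|a| <= h%:Z -> l a = l' a.
  move=> ha; have := congr1 (fun t => nth true t (absz (a + h%:Z))) e.
  rewrite !nth_mkseq; [|lia..].
  by have -> : (absz (a + h%:Z))%:Z - h%:Z = a by lia.
apply/rp_restrP; split=> [//|a b ha hb].
by rewrite /= /le321 !ll.
Qed.

Lemma measurable_window (h : nat) (b : seq bool) :
  measurable [set w | window h (fun x => L x w) = b].
Proof.
have [bh|bh] := eqVneq (size b) h.*2.+1; last first.
  rewrite (_ : [set _ | _] = set0)//; apply/seteqP; split=> // w /= e.
  by move: bh; rewrite -e size_mkseq eqxx.
rewrite (_ : [set _ | _] = \bigcap_(k in `I_h.*2.+1)
    (L (k%:Z - h%:Z) @^-1` [set nth true b k])).
  apply: fin_bigcap_measurable => // k _.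
  by rewrite -[X in measurable X]setTI; exact: measurable_funPT.
apply/seteqP; split=> [w /= e k kh|w e].
  by rewrite /= -e nth_mkseq.
apply: (@eq_from_nth _ true); rewrite ?size_mkseq// => k kh.
by rewrite nth_mkseq//; exact: e.
Qed.

Lemma measurable_random_order321 : measurable_fun setT random_order321.
Proof.
apply: (measurability (@open (rooted_space R))) => // _ [U oU <-].
rewrite setTI.
pose good h b := forall l, window h l = b -> U (rp321 l).
rewrite (_ : _ @^-1` _ = \bigcup_(h : nat) \bigcup_(b : seq bool)
    [set w | good h b /\ window h (fun x => L x w) = b]).
  apply: bigcupT_measurable => h; apply: countable_bigcupT_measurable => // b.
  have [g|g] := pselect (good h b).
    rewrite (_ : [set _ | _] = [set w | window h (fun x => L x w) = b]).
      exact: measurable_window.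
    by apply/seteqP; split=> w /=; tauto.
  by rewrite (_ : [set _ | _] = set0)//; apply/seteqP; split=> w /=; tauto.
apply/seteqP; split=> [w /= Uw|w [h _ [b _ [g e]]]]; last exact: g.
have /nbhs_ballP[e /= e0 eU] : nbhs (random_order321 w) U by exact: open_nbhs_nbhs.
pose h := (Num.truncn e^-1).+1.
exists h => //; exists (window h (fun x => L x w)) => //; split=> // l lw.
apply: eU; rewrite ballEmdist /=.
apply: le_lt_trans (_ : 2 `^ (- h%:R) < e).
  by apply: local_dist_le => //; apply: window_agree.
rewrite powRN powR_mulrn// -[ltRHS]invrK ltf_pV2 ?posrE ?invr_gt0 ?exprn_gt0//.
apply: lt_trans (truncnS_gt _) _.
by rewrite -natrX ltr_nat ltn_expl.
Qed.

HB.instance Definition _ :=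
  isMeasurableFun.Build _ _ _ _ random_order321 measurable_random_order321.

End random_order321.

(* Main.v *)
(* A 321-avoiding permutation of size n is increasing on its weak exceedances
   and on the other positions. It is therefore encoded by the positions and the
   values of its weak exceedances, interleaved into a word of length 2 n, and
   the words obtained are exactly the Dyck words. Where the path is high, all
   the weak exceedances of a window lie above its other values, so the pattern of
   the window is that of the order 321 built on the labels "weak exceedance".

   In a uniform Dyck word with a uniform root the labels become independent and
   fair. Letters of a high window are exchangeable, and two consecutive letters
   are UD with probability at least 1/4 - o(1), by insertion of a factor UD and
   Cat (n+1) <= 4 Cat n. Hence the signs of the letters of the window are
   asymptotically not positively correlated, their average over a long window is
   small in mean square, and by exchangeability so is the bias of any given label
   knowing the previous ones. Low roots are negligible: a root of height k
   can be turned into a first return to 0, so there are at most Cat (n+k+1).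

   Thus a set U determined by a window has limiting mean mass at least its
   probability for the order 321; the mass of U is a continuous functional, so
   its limiting mean is the probability of U for the quenched limit. The same
   holds for the complement of U, whence equality, and the open sets are
   increasing unions of such sets. *)
Require Import Defs.
From mathcomp Require Import all_boot all_order all_algebra fingroup perm zify lra.
From mathcomp Require Import all_classical all_reals all_analysis measurable_realfun.

Set Implicit Arguments.
Unset Strict Implicit.
Unset Printing Implicit Defensive.

Import Order.TTheory GRing.Theory Num.Theory.
Import numFieldNormedType.Exports.

(** * Dyck words *)

(* The height reached from height [k] by the up steps [true] and down steps
   [false] of [s], or [None] if the path becomes negative. *)
Fixpoint run (k : nat) (s : seq bool) : option nat :=
  match s with
  | [::] => Some k
  | true :: s' => run k.+1 s'
  | false :: s' => if k is k'.+1 then run k' s' else None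
  end.

Lemma run_cat k s t : run k (s ++ t) = obind (run^~ t) (run k s).
Proof. by elim: s k => //= -[] s IH [|k] //=. Qed.

Lemma run_count k s l : run k s = Some l ->
  l + count negb s = k + count id s.
Proof.
elim: s k => [k [->]|[] s IH [|k]] //=; rewrite ?add0n.
- by move=> /IH; lia.
- by move=> /IH; lia.
- by move=> /IH; lia.
Qed.

Lemma run_shift j k s l : run k s = Some l -> run (k + j) s = Some (l + j).
Proof.
elim: s k => [k [->]|[] s IH [|k]] //=.
- by move=> /IH.
- by move=> /IH.
- by move=> /IH.
Qed.

Lemma run_prefixP k s :
  reflect (forall p, count negb (take p s) <= k + count id (take p s))
    (run k s != None).
Proof.
elim: s k => [|[] s IH] k; first by left.
- apply: (iffP (IH k.+1)) => H p.
    by case: p => //= p; have := H p; lia.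
  by have /= := H p.+1; lia.
- case: k => [|k] /=.
    by right => /(_ 1); rewrite /= take0.
  apply: (iffP (IH k)) => H p.
    by case: p => //= p; have := H p; lia.
  by have /= := H p.+1; lia.
Qed.

Lemma count_negb s : count id s + count negb s = size s.
Proof. by rewrite -(count_predC id s). Qed.

(** A path that starts at least as high as its length cannot become negative, so its end depends
    only on the letter counts. This makes the letters of a high window exchangeable. *)
Lemma run_large k s : size s <= k ->
  run k s = Some (k + count id s - count negb s).
Proof.
move=> sk; case E : (run k s) => [l|]; first by rewrite -(run_count E) addnK.
suff : run k s != None by rewrite E.
apply/run_prefixP => p; apply: leq_trans (leq_addr _ _).
apply: leq_trans (count_size _ _) _; rewrite size_take_min; lia.
Qed.

Lemma run_ups k j : run k (nseq j true) = Some (k + j).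
Proof. by elim: j k => [|j IH] k /=; rewrite ?addn0// IH addSnnS. Qed.

Lemma run_downs k j : j <= k -> run k (nseq j false) = Some (k - j).
Proof. by elim: j k => [|j IH] [|k]//= jk; rewrite IH. Qed.

(** * Enumeration of Dyck words and Catalan growth *)

Definition words m : seq (seq bool) := [seq tval t | t <- enum {: m.-tuple bool}].

Lemma mem_words m (s : seq bool) : (s \in words m) = (size s == m).
Proof.
apply/mapP/eqP => [[t _ ->]|sm]; first by rewrite size_tuple.
by move/eqP: sm => sm; exists (Tuple sm) => //; rewrite mem_enum.
Qed.

Lemma words_uniq m : uniq (words m).
Proof. by rewrite map_inj_uniq ?enum_uniq//; exact: val_inj. Qed.

Definition paths k m : seq (seq bool) := [seq s <- words m | run k s == Some 0].

Lemma mem_paths k m (s : seq bool) : (s \in paths k m) = (run k s == Some 0) && (size s == m).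
Proof. by rewrite mem_filter mem_words. Qed.

Lemma paths_uniq k m : uniq (paths k m).
Proof. by rewrite filter_uniq ?words_uniq. Qed.

Definition dycks n := paths 0 n.*2.

Lemma perm_pathsS k m : perm_eq (paths k m.+1)
  ([seq true :: s | s <- paths k.+1 m] ++
   (if k is k'.+1 then [seq false :: s | s <- paths k' m] else [::])).
Proof.
have inj b : injective (cons b : seq bool -> _) by move=> x y [].
apply: uniq_perm.
- exact: paths_uniq.
- rewrite cat_uniq map_inj_uniq ?paths_uniq//=; case: k => [|k] //=.
  rewrite map_inj_uniq ?paths_uniq// andbT.
  by apply/hasPn => _ /mapP[s _ ->]; apply/negP => /mapP[].
- move=> s; rewrite mem_paths mem_cat.
  case: s => [|[] s] /=.
  + rewrite andbF; apply/esym/negbTE; rewrite negb_or.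
    apply/andP; split; first by apply/negP => /mapP[].
    by case: k => // k; apply/negP => /mapP[].
  + rewrite mem_map// mem_paths eqSS; case: k => [|k]; first by rewrite orbF.
    by rewrite orb_idr// => /mapP[].
  + rewrite (_ : (_ \in map (cons true) _) = false); last first.
      by apply/negP => /mapP[].
    case: k => [|k] //=; by rewrite mem_map// mem_paths eqSS.
Qed.

Lemma size_pathsS k m : size (paths k m.+1) =
  size (paths k.+1 m) + (if k is k'.+1 then size (paths k' m) else 0).
Proof.
rewrite (perm_size (perm_pathsS k m)) size_cat size_map; case: k => // k.
by rewrite size_map.
Qed.

Lemma size_paths_lt k m : m < k -> size (paths k m) = 0.
Proof.
move=> mk; apply/eqP; rewrite size_eq0; apply/eqP.
case E : (paths k m) => [//|s t].
have : s \in paths k m by rewrite E mem_head.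
rewrite mem_paths => /andP[/eqP/run_count /= H /eqP sm].
by have := count_negb s; lia.
Qed.

(* The recursion of the ballot numbers [x], [y], proportional to the binomials
   [c], [d], with denominators cleared. *)
Lemma ballot_step (x y c d u k : nat) :
  x * (u + k.+3) = k.+3 * c -> y * (u + k.+2) = k.+1 * d ->
  d * u.+1 = c * (u + k.+2) ->
  (x + y) * (u + k.+3) = k.+2 * (c + d).
Proof.
rewrite (addnS u k.+2); set p := u + k.+2 => hx hy hd.
have p0 : 0 < p by rewrite /p addnS.
apply/eqP; rewrite -(eqn_pmul2r p0) mulnDl mulnDl hx; apply/eqP.
have -> : k.+3 * c * p = k.+3 * (d * u.+1) by rewrite hd mulnA.
have -> : y * p.+1 * p = (k.+1 * d) * p.+1 by rewrite -hy mulnAC.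
have -> : k.+2 * (c + d) * p = k.+2 * (d * u.+1) + k.+2 * d * p.
  by rewrite hd; nia.
by rewrite /p; nia.
Qed.

(** The ballot theorem for paths from [k] to 0 with [u] up steps, free of division; [k = 0] gives
    the Catalan numbers. The induction on [u], then on [k], follows the first step of the path. *)
Lemma ballot u k :
  size (paths k (u.*2 + k)) * (u + k).+1 = k.+1 * 'C(u.*2 + k, u).
Proof.
elim: u k => [|u IHu].
  elim=> [|k IHk].
    rewrite bin0 !muln1 (@perm_size _ _ [:: [::]])//.
    apply: uniq_perm => //; first exact: paths_uniq.
    by move=> s; rewrite mem_paths inE; case: s => [|[] s]//=; rewrite andbF.
  rewrite double0 !add0n bin0 !muln1 in IHk *; rewrite size_pathsS size_paths_lt//.
  rewrite add0n mulnS. move: IHk => /eqP.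
  by rewrite -[X in _ == X -> _]mul1n eqn_pmul2r// => /eqP->; rewrite mul1n.
elim=> [|k IHk].
  rewrite (_ : u.+1.*2 + 0 = (u.*2 + 1).+1); last by lia.
  rewrite size_pathsS addn0; have := IHu 1.
  rewrite addn0 !addn1 => ->; rewrite mul1n binS.
  rewrite (_ : 'C(u.*2.+1, u.+1) = 'C(u.*2.+1, u)); first by lia.
  by rewrite -bin_sub; [congr binomial|]; lia.
rewrite (_ : u.+1.*2 + k.+1 = (u.*2 + k.+2).+1); last by lia.
rewrite size_pathsS (_ : (u.+1 + k.+1).+1 = u + k.+3); last by lia.
rewrite binS (addnC 'C(_, u.+1)); apply: ballot_step.
- by rewrite -IHu; congr (_ * _); lia.
- rewrite (_ : u.*2 + k.+2 = u.+1.*2 + k); last by lia.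
  by rewrite -IHk; congr (_ * _); lia.
- by rewrite mulnC mul_bin_left mulnC; congr (_ * _); lia.
Qed.

(** The ratio of consecutive Catalan numbers is (4 n + 2) / (n + 2). *)
Lemma size_dycksS n : size (dycks n.+1) <= 4 * size (dycks n).
Proof.
have B m : size (dycks m) * m.+1 = 'C(m.*2, m).
  by have := ballot m 0; rewrite !addn0 mul1n.
have C : 'C(n.+1.*2, n.+1) * n.+1 = 2 * n.*2.+1 * 'C(n.*2, n).
  have e : 'C(n.*2.+1, n.+1) = 'C(n.*2.+1, n).
    by rewrite -bin_sub; [congr binomial|]; lia.
  rewrite doubleS binS e -mulnA [n.*2.+1 * _](mul_bin_down n.*2.+1 n).
  rewrite (_ : n.*2.+1 - n = n.+1); [nia|lia].
rewrite -(@leq_pmul2r (n.+2 * n.+1))// mulnA B C -B.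
have -> : 4 * size (dycks n) * (n.+2 * n.+1) =
  4 * n.+2 * (size (dycks n) * n.+1) by nia.
by rewrite leq_mul2r; apply/orP; right; lia.
Qed.

Lemma size_dycksD n k : size (dycks (n + k)) <= 4 ^ k * size (dycks n).
Proof.
elim: k => [|k IH]; first by rewrite addn0 mul1n.
rewrite addnS expnS -mulnA; apply: leq_trans (size_dycksS _) _.
by rewrite leq_mul2l IH orbT.
Qed.

Lemma size_dycks_gt0 n : 0 < size (dycks n).
Proof.
rewrite -has_predT; apply/hasP; exists (nseq n true ++ nseq n false) => //.
rewrite mem_paths run_cat run_ups /= add0n run_downs// subnn eqxx /=.
by rewrite size_cat !size_nseq addnn.
Qed.

(* If [s] has height [k] at [2 i], the first return of the detour to height 0 is
   at [2 i + k + 2], so that [i] and [s] can be recovered. *)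
Definition detour (k i : nat) (s : seq bool) : seq bool :=
  [:: true] ++ take i.*2 s ++ nseq k.+1 false ++ nseq k true ++ drop i.*2 s.

Lemma detour_inj k i j s t : i <= j ->
  run 0 (take i.*2 s) = Some k -> run 0 (take j.*2 t) = Some k ->
  i.*2 <= size s -> j.*2 <= size t ->
  detour k i s = detour k j t -> i = j /\ s = t.
Proof.
move=> ij hs ht si tj; rewrite /detour => /(congr1 (drop 1)).
rewrite !(drop_size_cat _ (erefl : size [:: true] = 1)) => E.
have [e|ne] := eqVneq i j.
  subst j; split=> //; move/eqP: E; rewrite eqseq_cat ?size_takel//.
  by case/andP=> /eqP e1; rewrite !eqseq_cat// !eqxx /= => /eqP e2;
    rewrite -(cat_take_drop i.*2 s) e1 e2 cat_take_drop.
have {}ij : i < j by rewrite ltn_neqAle ne.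
exfalso.
(* Without its initial up step, the detour of [s] becomes negative after 2 i + k + 1 letters. That
   of [t] does not: there it is still inside the prefix of [t], or at most [k] steps down from
   height [k]. *)
have : run 0 (take (i.*2 + k.+1) (take i.*2 s ++ nseq k.+1 false ++
   nseq k true ++ drop i.*2 s)) = None.
  rewrite takeD take_size_cat ?drop_size_cat ?take_size_cat ?size_takel ?size_nseq//.
  by rewrite run_cat hs -addn1 nseqD /= run_cat run_downs// subnn.
rewrite E; case: (leqP (i.*2 + k.+1) j.*2) => h.
  rewrite takel_cat ?size_takel// => e.
  by move: ht; rewrite -(cat_take_drop (i.*2 + k.+1) (take j.*2 t)) run_cat e.
rewrite -(subnKC (ltnW h)) takeD take_size_cat ?drop_size_cat ?size_takel//.
rewrite takel_cat ?size_nseq; last by lia.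
by rewrite take_nseq ?run_cat ?ht /= ?run_downs//; lia.
Qed.

(** The detour adds 2 (k + 1) letters and maps the pairs of a root and a word of height [k] there
    injectively into longer Dyck words. *)
Lemma low_heights (n k : nat) :
  \sum_(i < n) count (fun s => run 0 (take i.*2 s) == Some k) (dycks n) <=
  size (dycks (n + k.+1)).
Proof.
pose A := [seq (i, s) | i : 'I_n <- enum 'I_n,
  s : seq bool <- [seq s <- dycks n | run 0 (take i.*2 s) == Some k]].
have -> : \sum_(i < n) count (fun s => run 0 (take i.*2 s) == Some k) (dycks n) =
  size A.
  rewrite size_allpairs_dep sumnE big_map big_enum /=.
  by apply: eq_bigr => i _; rewrite size_filter.
rewrite -(size_map (fun x => detour k (val x.1) x.2)); apply: uniq_leq_size.
  rewrite map_inj_in_uniq.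
    apply: allpairs_uniq_dep; first exact: enum_uniq.
      by move=> i _; rewrite filter_uniq ?paths_uniq.
    by move=> [? ?] [? ?] _ _ /= [-> ->].
  have P i s : (i, s) \in A -> run 0 (take i.*2 s) = Some k /\ (i.*2 <= size s).
    case/allpairsPdep => j [t [_]]; rewrite mem_filter mem_paths.
    move=> /andP[/eqP + /andP[_ /eqP st]] [-> ->].
    by split=> //; rewrite st; have := ltn_ord j; lia.
  move=> [i s] [j t] /P[r1 l1] /P[r2 l2] /= E.
  have [ij|/ltnW ij] := leqP i j.
    by have [/val_inj -> ->] := detour_inj ij r1 r2 l1 l2 E.
  by have [/val_inj -> ->] := detour_inj ij r2 r1 l2 l1 (esym E).
move=> _ /mapP[_ /allpairsPdep[j [s [_ + ->]]] ->].
rewrite mem_filter !mem_paths => /andP[/eqP r /andP[/eqP d /eqP st]].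
have jn := ltn_ord j; rewrite /detour [(_, _).1]/= [(_, _).2]/=.
apply/andP; split; last first.
  by rewrite !size_cat !size_nseq size_drop size_takel st/=; lia.
rewrite run_cat -[obind _ _]/(run 1 _) run_cat (run_shift 1 r) addn1.
rewrite -[obind _ _]/(run k.+1 _) run_cat run_downs// subnn.
rewrite -[obind _ _]/(run 0 _) run_cat run_ups add0n.
by move: d; rewrite -{1}(cat_take_drop j.*2 s) run_cat r /= => ->.
Qed.

(** Inserting UD at position 2 i is injective and keeps the word Dyck. *)
Lemma count_updown n i : i <= n -> size (dycks n) <=
  count (fun s => nth false s i.*2 && ~~ nth false s i.*2.+1) (dycks n.+1).
Proof.
move=> lein; pose ins s := take i.*2 s ++ [:: true; false] ++ drop i.*2 s.
have sz s : s \in dycks n -> size (take i.*2 s) = i.*2.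
  by rewrite mem_paths => /andP[_ /eqP st]; rewrite size_takel// st leq_double.
rewrite -size_filter -(size_map ins); apply: uniq_leq_size.
  rewrite map_inj_in_uniq ?paths_uniq// => s t /sz ss /sz st /eqP.
  rewrite /ins eqseq_cat ?ss// => /andP[/eqP e1].
  rewrite eqseq_cat// => /andP[_ /eqP e2].
  by rewrite -(cat_take_drop i.*2 s) e1 e2 cat_take_drop.
move=> _ /mapP[s sD ->]; have ss := sz _ sD; rewrite mem_filter mem_paths.
rewrite !nth_cat ss ltnn (ltnNge i.*2.+1) leqnSn subnn subSnn /=.
move: sD; rewrite mem_paths => /andP[/eqP d /eqP st].
apply/andP; split; last by rewrite !size_cat ss size_drop st /=; lia.
rewrite run_cat; move: d; rewrite -{1}(cat_take_drop i.*2 s) run_cat.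
by case: (run 0 _) => //= k ->.
Qed.

(* The position [2 i] of the word carries the label of the root [i]. *)
Definition high K i s := if run 0 (take i.*2 s) is Some k then K <= k else false.

(** The sum of [low_heights] over the heights below [K]. The factor does not depend on [n], so a
    uniform root is low with probability O(1/n). *)
Lemma count_low_heights n K :
  \sum_(i < n) count (predC (high K i)) (dycks n) <=
  (\sum_(k < K) 4 ^ k.+1) * size (dycks n).
Proof.
rewrite big_distrl /=.
apply: (@leq_trans (\sum_(k < K) \sum_(i < n)
  count (fun s => run 0 (take i.*2 s) == Some (val k)) (dycks n))); last first.
  apply: leq_sum => k _; apply: leq_trans (low_heights n k) _.
  exact: size_dycksD.
rewrite exchange_big /=; apply: leq_sum => i _.
rewrite (eq_in_count (a2 := fun s => [exists k : 'I_K, run 0 (take i.*2 s) == Some (val k)])).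
  elim: (dycks n) => [|s t IH] /=; first by [].
  rewrite big_split /= leq_add//; case: existsP => // -[k e].
  by rewrite (bigD1 k)//= e.
move=> s; rewrite mem_paths => /andP[/eqP d _] /=; rewrite /high.
move: d; rewrite -{1}(cat_take_drop i.*2 s) run_cat.
case: (run 0 _) => //= k _; rewrite -ltnNge.
apply/idP/existsP => [kK|[j /eqP[->]]//]; by exists (Ordinal kK).
Qed.

Lemma size_le_updown K n i : i < n -> size (dycks n) <= 4 *
  (count (fun s => nth false s i.*2 && ~~ nth false s i.*2.+1)
    [seq s <- dycks n | high K i s] + count (predC (high K i)) (dycks n)).
Proof.
case: n => // n lein; apply: leq_trans (size_dycksS n) _; rewrite leq_mul2l /=.
apply: leq_trans (count_updown (n := n) (i := i) _) _ => //.
elim: (dycks n.+1) => //= s t IH; case: ifP => _ /=; lia.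
Qed.

(** * Exchangeability of the letters of a high window *)

Definition transp (a b x : nat) := if x == a then b else if x == b then a else x.

Lemma transpK a b : involutive (transp a b).
Proof.
move=> x; rewrite /transp; have [->|xa] := eqVneq x a.
  by have [->|ba] := eqVneq b a; rewrite ?eqxx.
have [->|xb] := eqVneq x b; first by rewrite eqxx.
by rewrite (negbTE xa) (negbTE xb).
Qed.

Lemma transp_lt a b x m : a < m -> b < m -> (transp a b x < m) = (x < m).
Proof.
move=> am bm; rewrite /transp; case: eqVneq => [->|_]; first by rewrite am bm.
by case: eqVneq => [->|_] //; rewrite am bm.
Qed.

Definition swap a b (s : seq bool) := mkseq (fun x => nth false s (transp a b x)) (size s).

Lemma size_swap a b s : size (swap a b s) = size s.
Proof. exact: size_mkseq. Qed.

Lemma nth_swap a b s x : a < size s -> b < size s ->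
  nth false (swap a b s) x = nth false s (transp a b x).
Proof.
move=> sa sb; case: (ltnP x (size s)) => xs; first by rewrite nth_mkseq.
by rewrite !nth_default ?size_mkseq// leqNgt transp_lt// -leqNgt.
Qed.

Lemma swapK a b s : a < size s -> b < size s -> swap a b (swap a b s) = s.
Proof.
move=> sa sb; apply: (@eq_from_nth _ false); rewrite ?size_swap// => x xs.
by rewrite !nth_swap ?size_swap// transpK.
Qed.

Lemma perm_swap a b s : a < size s -> b < size s -> perm_eq (swap a b s) s.
Proof.
move=> sa sb; rewrite -[X in perm_eq _ X](mkseq_nth false) /swap /mkseq.
rewrite (map_comp (nth false s) (transp a b)); apply: perm_map.
apply: uniq_perm; rewrite ?iota_uniq//.
  by rewrite map_inj_uniq ?iota_uniq//; exact: inv_inj (transpK _ _).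
move=> x; rewrite mem_iota; apply/mapP/idP => [[y + ->]|xs].
  by rewrite mem_iota /= !add0n transp_lt.
by exists (transp a b x); rewrite ?transpK// mem_iota /= add0n transp_lt.
Qed.

Definition hdycks K i n := [seq s <- dycks n | high K i s].

(** The path before the window is unchanged. The window has [K] letters and starts at height at
    least [K], so any rearrangement of it stays nonnegative and ends at the same height, from which
    the rest is run as before. *)
Lemma swap_hdycks K i n a b (s : seq bool) : i.*2 <= a < i.*2 + K -> i.*2 <= b < i.*2 + K ->
  s \in hdycks K i n -> [/\ a < size s, b < size s & swap a b s \in hdycks K i n].
Proof.
move=> /andP[ia aK] /andP[ib bK]; rewrite !mem_filter !mem_words size_swap /high.
case E : (run 0 (take i.*2 s)) => [k|]; rewrite ?andbF// => /and3P[Kk /eqP d ss].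
(* The path has to come down from height at least [K] to 0, so at least [K] letters remain. *)
have sK : i.*2 + K <= size s.
  have := d; rewrite -{1}(cat_take_drop i.*2 s) run_cat E /= => /run_count.
  rewrite add0n => ck; have cs := count_negb (drop i.*2 s).
  by rewrite size_drop in cs; lia.
have [sa sb] : a < size s /\ b < size s by lia.
split=> //; rewrite ss andbT.
have e1 : take i.*2 (swap a b s) = take i.*2 s.
  apply: (@eq_from_nth _ false); rewrite !size_takel ?size_swap//; try lia.
  move=> x xi; rewrite !nth_take// nth_swap// /transp.
  by rewrite !ifF//; apply/negbTE; rewrite neq_ltn; lia.
have e2 : drop (i.*2 + K) (swap a b s) = drop (i.*2 + K) s.
  apply: (@eq_from_nth _ false); rewrite !size_drop ?size_swap//.
  move=> x xi; rewrite !nth_drop nth_swap// /transp.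
  by rewrite !ifF//; apply/negbTE; rewrite neq_ltn; lia.
have split3 t : t = take i.*2 t ++ take K (drop i.*2 t) ++ drop (i.*2 + K) t.
  by rewrite addnC -drop_drop !cat_take_drop.
have := perm_swap sa sb.
rewrite [X in perm_eq X _]split3 [X in perm_eq _ X]split3 e1 e2 perm_cat2l perm_cat2r.
move=> pe; rewrite E Kk [swap _ _ _]split3 e1 e2 run_cat E /= run_cat.
have szK t : size t = size s -> size (take K (drop i.*2 t)) = K.
  by move=> st; rewrite size_takel// size_drop st; lia.
rewrite run_large ?szK ?size_swap//= !(seq.permP pe).
move: d; rewrite {1}[s]split3 run_cat E /= run_cat.
by rewrite run_large ?szK//= => ->.
Qed.

Definition labels w i (s : seq bool) := mkseq (fun j => nth false s (i + j).*2) w.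

Lemma labelsS w i s : labels w.+1 i s = rcons (labels w i s) (nth false s (i + w).*2).
Proof. by rewrite /labels /mkseq -addn1 iotaD map_cat cats1. Qed.

(** * 321-avoiding permutations *)

Section monotone.
Variable n : nat.
Implicit Types (A B : {set 'I_n}) (s t : 'S_n).

Definition mono_on s A := {in A &, forall x y : 'I_n, x < y -> s x < s y}.

Definition below A m := #|[set x in A | x < m]%SET|.

Lemma below_le A m k : m <= k -> below A m <= below A k.
Proof.
move=> mk; apply: subset_leq_card; apply/fintype.subsetP => x.
by rewrite !inE => /andP[-> /leq_trans]; exact.
Qed.

Lemma belowS A (x : 'I_n) : below A x.+1 = (x \in A) + below A x.
Proof.
rewrite /below (cardsD1 x) !inE ltnSn andbT; congr (_ + _).
apply: eq_card => y; rewrite !inE ltnS [in RHS]ltn_neqAle.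
by case: (y \in A); rewrite /= ?andbF.
Qed.

Lemma below_leD A m k : below A (m + k) <= below A m + k.
Proof.
elim: k => [|k IH]; first by rewrite !addn0.
rewrite !addnS; have [mn|nm] := ltnP (m + k) n.
  by rewrite (belowS A (Ordinal mn)) /=; case: (_ \in A); lia.
apply: leq_trans (leq_trans IH (leqnSn _)); apply: subset_leq_card.
apply/fintype.subsetP => x; rewrite !inE => /andP[-> _] /=.
exact: leq_trans (ltn_ord x) nm.
Qed.

Lemma below_setC A m : m <= n -> below (~: A) m + below A m = m.
Proof.
elim: m => [_|m IH mn].
  by rewrite /below !(eq_card0 (A := _)) // => x; rewrite !inE ltn0 andbF.
have := IH (ltnW mn).
by rewrite (belowS _ (Ordinal mn)) (belowS A (Ordinal mn)) inE /=; case: (_ \in A) => /=; lia.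
Qed.

Lemma below_all A : below A n = #|A|.
Proof. by apply: eq_card => x; rewrite !inE ltn_ord andbT. Qed.

Lemma below_imset s A (x : 'I_n) : mono_on s A -> x \in A ->
  below (s @: A) (s x) = below A x.
Proof.
move=> sA xA; rewrite /below -[RHS](card_imset _ (@perm_inj _ s)); apply: eq_card => v.
apply/idP/imsetP => [|[y]].
  rewrite !inE => /andP[/imsetP[y yA ->] yx]; exists y => //.
  rewrite inE yA ltnNge leq_eqVlt; apply/negP => /orP[/eqP/val_inj e|xy].
    by move: yx; rewrite e ltnn.
  by have := sA _ _ xA yA xy; lia.
by rewrite !inE => /andP[yA yx] ->; rewrite imset_f//= sA.
Qed.

(** The rank of [x] in [A] is the rank of its image in the common image set, and an element of a set
    is determined by its rank. *)
Lemma mono_on_eq s t A : mono_on s A -> mono_on t A -> s @: A = t @: A ->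
  {in A, s =1 t}.
Proof.
move=> sA tA e x xA; apply/val_inj/eqP; rewrite eqn_leq.
have H (u v : 'S_n) : mono_on u A -> mono_on v A -> u @: A = v @: A -> u x <= v x.
  move=> uA vA uv; rewrite leqNgt; apply/negP => vu.
  have := below_imset uA xA; rewrite -(below_imset vA xA) uv => E.
  have := below_le (v @: A) vu; rewrite belowS imset_f//; lia.
by rewrite !H.
Qed.

Lemma mono_on_inj s t A : mono_on s A -> mono_on s (~: A) ->
  mono_on t A -> mono_on t (~: A) -> s @: A = t @: A -> s = t.
Proof.
move=> sA sC tA tC e; apply/permP => x; have [xA|xA] := boolP (x \in A).
  exact: (mono_on_eq sA tA).
apply: (mono_on_eq sC tC); rewrite ?inE//.
have imC (u : 'S_n) : u @: (~: A) = ~: (u @: A).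
  apply/setP => v; rewrite !inE; rewrite -(permKV u v) !mem_imset ?inE//; exact: perm_inj.
by rewrite !imC e.
Qed.

Lemma sorted_enum_set A : sorted (fun x y : 'I_n => x < y) (enum A).
Proof.
rewrite {1}/enum_mem; apply: sorted_filter; first by move=> x y z; exact: ltn_trans.
rewrite -enumT -[sorted _ _]/(sorted (relpre (fun x : 'I_n => x : nat) ltn) _).
by rewrite -sorted_map val_enum_ord iota_ltn_sorted.
Qed.

(** The permutation sends the element of each rank in [A] to the one of the same rank in [B], and
    does likewise on the complements. *)
Lemma mono_perm_exists A B : #|A| = #|B| ->
  exists s : 'S_n, [/\ mono_on s A, mono_on s (~: A) & s @: A = B].
Proof.
move=> AB; have CAB : #|~: A| = #|~: B|.
  by apply/eqP; rewrite -(eqn_add2l #|A|) cardsC {1}AB cardsC.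
pose g (C D : {set 'I_n}) x := nth x (enum D) (index x (enum C)).
have gD (C D : {set 'I_n}) x : #|C| = #|D| -> x \in C -> g C D x \in D.
  move=> cd xC; rewrite -mem_enum mem_nth// -cardE -cd cardE index_mem.
  by rewrite mem_enum.
have g_lt (C D : {set 'I_n}) (x y : 'I_n) : #|C| = #|D| ->
    x \in C -> y \in C -> (x < y)%N -> (g C D x < g C D y)%N.
  move=> cd xC yC xy; rewrite /g (set_nth_default x y); last first.
    by rewrite -cardE -cd cardE index_mem mem_enum.
  have tr : transitive (fun x y : 'I_n => x < y) by move=> ? ? ?; exact: ltn_trans.
  apply: (sorted_ltn_nth tr x (sorted_enum_set D));
    rewrite ?inE -?cardE -?cd ?cardE ?index_mem ?mem_enum//.
  rewrite ltnNge; apply/negP => yx.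
  have [e|ne] := eqVneq (index y (enum C)) (index x (enum C)).
    have : y = x by rewrite -(nth_index x (_ : y \in enum C)) ?mem_enum// e nth_index ?mem_enum.
    by move=> e'; rewrite e' ltnn in xy.
  have {ne}yx : (index y (enum C) < index x (enum C))%N by rewrite ltn_neqAle ne.
  have := sorted_ltn_nth tr x (sorted_enum_set C) (index y (enum C)) (index x (enum C)).
  rewrite !inE !index_mem !mem_enum !nth_index ?mem_enum// => /(_ yC xC yx).
  lia.
pose f x := if x \in A then g A B x else g (~: A) (~: B) x.
have fE x : (f x \in B) = (x \in A).
  rewrite /f; case: ifP => xA; first by rewrite gD.
  have : g (~: A) (~: B) x \in ~: B by rewrite gD// inE xA.
  by rewrite inE => /negbTE.
have f_inj : injective f.
  move=> x y e; have := fE x; rewrite e fE => xy.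
  wlog : x y e xy / (x <= y)%N.
    by move=> H; case/orP: (leq_total x y) => /H; [exact|move=> -> //].
  rewrite leq_eqVlt => /orP[/eqP/val_inj//|lt].
  move: e; rewrite /f -xy; case: ifPn => yA e.
    by have := g_lt A B _ _ AB _ _ lt; rewrite e ltnn -xy yA => /(_ isT isT).
  by have := g_lt (~: A) (~: B) _ _ CAB _ _ lt; rewrite e ltnn !inE -xy yA => /(_ isT isT).
exists (perm f_inj); split.
- by move=> x y xA yA xy; rewrite !permE /f xA yA g_lt.
- move=> x y; rewrite !inE => xA yA xy; rewrite !permE /f (negbTE xA) (negbTE yA) g_lt//.
  + by rewrite inE.
  + by rewrite inE.
apply/eqP; rewrite eqEcard card_imset ?AB ?leqnn ?andbT; last exact: perm_inj.
by apply/fintype.subsetP => _ /imsetP[x xA ->]; rewrite permE fE.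
Qed.

End monotone.

(* The letter [2 x] of the word tells whether the position [x] is a weak
   exceedance, the letter [2 v + 1] whether the value [v] is not that of one. *)
Definition excs n (s : seq bool) : {set 'I_n} := [set x : 'I_n | nth false s x.*2]%SET.
Definition vals n (s : seq bool) : {set 'I_n} := [set v : 'I_n | ~~ nth false s v.*2.+1]%SET.

Lemma below0 n (A : {set 'I_n}) : below A 0 = 0.
Proof. by apply: eq_card0 => x; rewrite !inE ltn0 andbF. Qed.

(** Odd letters are up exactly off [vals], so they contribute [i - below (vals n s) i] up steps; the
    subtracted term is moved to the left. The height at 2 i is thus twice the difference of the two
    [below] counts. *)
Lemma count_ups_even n (s : seq bool) i : size s = n.*2 -> i <= n ->
  count id (take i.*2 s) + below (vals n s) i = below (excs n s) i + i.
Proof.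
move=> sn; elim: i => [_|i IH ni]; first by rewrite take0 !below0.
have := IH (ltnW ni).
rewrite doubleS !(take_nth false) ?sn; try by lia.
rewrite -!cats1 !count_cat /=.
rewrite (belowS _ (Ordinal ni)) (belowS (excs n s) (Ordinal ni)) !inE /=.
by do 2!case: (nth false s _) => /=; lia.
Qed.

Lemma count_ups_odd n (s : seq bool) i : size s = n.*2 -> i < n ->
  count id (take i.*2.+1 s) + below (vals n s) i = below (excs n s) i.+1 + i.
Proof.
move=> sn ni; have := count_ups_even sn (ltnW ni).
rewrite (take_nth false) ?sn; last by lia.
rewrite -cats1 count_cat /= (belowS (excs n s) (Ordinal ni)) inE /=; lia.
Qed.

Lemma dycksP n (s : seq bool) : reflect [/\ size s = n.*2, count id s = n &
    forall p, p <= n.*2 -> p <= (count id (take p s)).*2] (s \in dycks n).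
Proof.
rewrite mem_paths; apply: (iffP andP) => [[/eqP r /eqP sn]|[sn cn H]].
  have cn := run_count r; have cs := count_negb s.
  split=> //; first by lia.
  move=> p ps; have /run_prefixP/(_ p) : run 0 s != None by rewrite r.
  by have := count_negb (take p s); rewrite size_takel ?sn//; lia.
rewrite sn; split=> //.
have /run_prefixP : forall p, count negb (take p s) <= 0 + count id (take p s).
  move=> p; have [ps|ps] := leqP p n.*2.
    by have := H p ps; have := count_negb (take p s); rewrite size_takel ?sn//; lia.
  have -> : take p s = s by rewrite take_oversize// sn ltnW.
  by have := count_negb s; lia.
case E : (run 0 s) => [m|//] _; apply/eqP; congr Some.
by have := run_count E; have := count_negb s; lia.
Qed.

(** The strict inequality is nonnegativity after 2 i + 1 letters; it implies nonnegativity after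
    even lengths, since [below] grows by at most 1. Equal cardinals mean that the path ends at 0. *)
Lemma dycks_belowP n (s : seq bool) : size s = n.*2 ->
  reflect ((forall i, i < n -> below (vals n s) i < below (excs n s) i.+1) /\
           #|excs n s| = #|vals n s|) (s \in dycks n).
Proof.
move=> sn; have Ee i := @count_ups_even n s i sn; have Eo i := @count_ups_odd n s i sn.
have En := Ee n (leqnn n); rewrite !below_all -sn take_size in En.
apply: (iffP (dycksP _ _)) => [[_ cn H]|[H PV]].
  split=> [i ni|]; last by lia.
  by have := H i.*2.+1; have := Eo i ni; lia.
split=> //; first by lia.
have ev i : i <= n -> below (vals n s) i <= below (excs n s) i.
  case: i => [|i ni]; first by rewrite !below0.
  by have := H i ni; have := below_leD (vals n s) i 1; rewrite addn1; lia.
move=> p pn; rewrite -(odd_double_half p) in pn *.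
case: (odd p) pn => /= pn.
  by rewrite add1n; have := H p./2; have := Eo p./2; lia.
by rewrite add0n; have := ev p./2; have := Ee p./2; lia.
Qed.

(** By [mono_on_inj], at most one permutation matches a given word. *)
Definition avoiding_match n (s : seq bool) (t : 'S_n) :=
  [/\ mono_on t (excs n s), mono_on t (~: excs n s) & t @: excs n s = vals n s].

Section matching.
Variables (n : nat) (s : seq bool) (t : 'S_n).
Hypotheses (sD : s \in dycks n) (st : avoiding_match s t).
Local Notation P := (excs n s).
Local Notation V := (vals n s).

Let below_lt i : i < n -> below V i < below P i.+1.
Proof.
have [sn _ _] := dycksP _ _ sD.
by have /(dycks_belowP sn)[H _] := sD; exact: H.
Qed.

(** The ranks of [x] in [P] and of [t x] in [V] agree. If [t x < x], then [V] has more than that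
    rank below [x], against [below_lt]. *)
Lemma matching_ge x : x \in P -> x <= t x.
Proof.
move=> xP; have [mP _ imP] := st; rewrite leqNgt; apply/negP => tx.
have := below_lt (ltn_ord x); rewrite belowS xP -(below_imset mP xP) imP.
have := below_le V tx; rewrite belowS -imP imset_f//; lia.
Qed.

(** The same comparison of ranks, in the complements of [P] and [V]. *)
Lemma matching_lt x : x \notin P -> t x < x.
Proof.
move=> xP; have [_ mC imP] := st; rewrite ltnNge; apply/negP => tx.
have imC : t @: (~: P) = ~: V.
  rewrite -imP; apply/setP => v; rewrite -(permKV t v) !inE !mem_imset ?inE//; exact: perm_inj.
have xC : x \in ~: P by rewrite inE.
have := below_imset mC xC; rewrite imC.
have := below_setC P (ltnW (ltn_ord x)); have := below_setC V (ltnW (ltn_ord x)).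
have := below_le (~: V) tx; have := below_lt (ltn_ord x).
by rewrite belowS (negbTE xP); lia.
Qed.

Lemma matching_excs : P = [set x : 'I_n | x <= t x]%SET.
Proof.
apply/setP => x; rewrite [RHS]finset.in_set; have [xP|xP] := boolP (x \in P).
  by apply/esym; exact: matching_ge.
by apply/esym/negbTE; rewrite -ltnNge; exact: matching_lt.
Qed.

Lemma matching_Av321 : t \in Av321 n.
Proof.
have [mP mC _] := st.
rewrite inE; apply/forallP => i; apply/forallP => j; apply/forallP => k.
apply/implyP => /andP[ij jk]; apply/negP => /andP[kj ji].
(* The two terms of an inversion lie in different classes, and three terms cannot lie in pairwise
   different classes out of two. *)
have Q (x y : 'I_n) : x < y -> t y < t x -> (x \in P) != (y \in P).
  move=> xy yx; apply/eqP => e; have [xP|xP] := boolP (x \in P).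
    by have := mP x y xP; rewrite -e => /(_ xP xy); lia.
  by have := mC x y; rewrite !finset.in_setC -e => /(_ xP xP xy); lia.
have := Q _ _ ij ji; have := Q _ _ jk kj; have := Q _ _ (ltn_trans ij jk) (ltn_trans kj ji).
by case: (i \in P); case: (j \in P); case: (k \in P).
Qed.

(** If [t j <= t k < k], then [V] has at least as many elements below [k] as [P] has up to [j]. Both
    counts move by at most 2 h from their values at [i], whose difference is half the height at 2 i.
    Hence that height would be at most 8 h. *)
Lemma matching_high h i (j k : 'I_n) : high (8 * h).+1 i s ->
  i <= j -> k <= i + h.*2 -> j \in P -> k \notin P -> t k < t j.
Proof.
move=> hi ij ki jP kP; rewrite ltnNge; apply/negP => tjk.
have tk := matching_lt kP; have tj := matching_ge jP.
have jk : j < k by lia.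
have [mP _ imP] := st.
have Bk : below P j.+1 <= below V k.
  rewrite belowS jP -(below_imset mP jP) imP.
  have := below_le V (leq_ltn_trans tjk tk); rewrite belowS -imP imset_f//.
have [sn _ _] := dycksP _ _ sD.
have Ak := below_leD P j.+1 (k - j.+1); rewrite subnKC// in Ak.
have Ai := below_le P (leq_trans ij (ltnW jk)).
have Bi := below_leD V i (k - i); rewrite subnKC in Bi; last by lia.
have iN : i <= n by have := ltn_ord j; lia.
have e3 := count_ups_even sn iN.
move: hi; rewrite /high; case E : (run 0 _) => [H|//] hH.
have e1 := run_count E; have e2 := count_negb (take i.*2 s).
rewrite size_takel ?sn in e2; last by lia.
lia.
Qed.

End matching.

Lemma matching_exists n s : s \in dycks n -> exists t : 'S_n, avoiding_match s t.
Proof.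
move=> sD; have [sn _ _] := dycksP _ _ sD.
have /(dycks_belowP sn)[_ PV] := sD.
by have [t [? ? ?]] := mono_perm_exists PV; exists t.
Qed.

Lemma matching_inj n s s' (t : 'S_n) : s \in dycks n -> s' \in dycks n ->
  avoiding_match s t -> avoiding_match s' t -> s = s'.
Proof.
move=> sD sD' m m'; have [sn _ _] := dycksP _ _ sD; have [sn' _ _] := dycksP _ _ sD'.
have eP := matching_excs sD m; rewrite -(matching_excs sD' m') in eP.
have eV : vals n s = vals n s' by case: m m' => _ _ <- [_ _ <-]; rewrite eP.
apply: (@eq_from_nth _ false); rewrite ?sn ?sn'// => p pn.
have hp : p./2 < n by lia.
rewrite -(odd_double_half p); case: (odd p).
  have /setP/(_ (Ordinal hp)) := eV; rewrite !finset.in_set /= add1n.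
  by move=> /(congr1 negb); rewrite !negbK.
by have /setP/(_ (Ordinal hp)) := eP; rewrite !finset.in_set.
Qed.

Lemma card_ord_lt n m : m <= n -> #|[set x : 'I_n | x < m]%SET| = m.
Proof.
move=> mn; have := below_setC (finset.set0 : {set 'I_n}) mn.
rewrite /below (eq_card0 (A := [set x in finset.set0 | _]%SET)); last first.
  by move=> x; rewrite finset.in_set finset.in_set0.
rewrite addn0 => e; rewrite -[RHS]e finset.setC0.
by apply: eq_card => x; rewrite !finset.in_set.
Qed.

Lemma card_perm_lt n m (t : 'S_n) : m <= n -> #|[set x : 'I_n | t x < m]%SET| = m.
Proof.
move=> mn; rewrite -[RHS](card_ord_lt mn) -(card_imset _ (@perm_inj _ t)).
apply: eq_card => v; rewrite -(permKV t v) mem_imset; last exact: perm_inj.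
by rewrite !finset.in_set.
Qed.

(** * From avoiding permutations to Dyck words *)

Section avoiding_word.
Variables (n : nat) (t : 'S_n).
Let A := [set x : 'I_n | x <= t x]%SET.

Definition word_of_perm : seq bool :=
  mkseq (fun p => if odd p then p./2 \notin [seq val (t x) | x in A]
                  else p./2 \in [seq val x | x in A]) n.*2.

Lemma excs_word : excs n word_of_perm = A.
Proof.
apply/setP => x; rewrite finset.in_set nth_mkseq; last by have := ltn_ord x; lia.
rewrite odd_double doubleK; apply/fintype.imageP/idP => [[y yA /val_inj ->]//|xA].
by exists x.
Qed.

Lemma vals_word : vals n word_of_perm = t @: A.
Proof.
apply/setP => x; rewrite finset.in_set nth_mkseq; last by have := ltn_ord x; lia.
rewrite /= odd_double /= uphalf_double negbK; apply/fintype.imageP/imsetP => -[y yA].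
  by move=> /val_inj ->; exists y.
by move=> ->; exists y.
Qed.

(** A weak exceedance of value below [i] has position below [i], which gives the weak inequality of
    counts. It is strict because some weak exceedance at a position up to [i] has value at least
    [i]. *)
Lemma word_of_perm_dyck : word_of_perm \in dycks n.
Proof.
apply/(dycks_belowP (size_mkseq _ _)); rewrite excs_word vals_word.
split; last by rewrite card_imset//; exact: perm_inj.
move=> i ni.
have -> : below (t @: A) i = #|[set x in A | t x < i]%SET|.
  rewrite /below -[RHS](card_imset _ (@perm_inj _ t)); apply: eq_card => v.
  rewrite -(permKV t v) finset.in_set !mem_imset ?finset.in_set//; exact: perm_inj.
rewrite /below; apply: proper_card; apply/properP; split.
  apply/fintype.subsetP => x; rewrite !finset.in_set => /andP[xt ti].
  by rewrite xt ltnS (leq_trans xt (ltnW ti)).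
apply: contrapT => H.
(* Otherwise the i + 1 positions up to [i] would all have one of the [i] values below [i]. *)
have sub : [set k : 'I_n | k < i.+1]%SET \subset [set k : 'I_n | t k < i]%SET.
  apply/fintype.subsetP => k; rewrite !finset.in_set ltnS => ki.
  rewrite ltnNge; apply/negP => ik; apply: H; exists k; rewrite !finset.in_set.
    by rewrite (leq_trans ki ik) ltnS.
  by rewrite negb_and -leqNgt ik orbT.
have := subset_leq_card sub.
by rewrite card_ord_lt// card_perm_lt ?ltnn// ltnW.
Qed.

Hypothesis tA : t \in Av321 n.

Lemma Av321P (i j k : 'I_n) : i < j -> j < k -> t k < t j -> t j < t i -> False.
Proof.
move: tA; rewrite finset.in_set => /forallP/(_ i)/forallP/(_ j)/forallP/(_ k).
by move=> /implyP H ij jk kj ji; have := H; rewrite ij jk kj ji => /(_ isT).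
Qed.

Let perm_lt_neq (x y : 'I_n) : x < y -> t y <= t x -> t y < t x.
Proof.
move=> xy yx; rewrite ltn_neqAle yx andbT; apply/eqP => /val_inj/perm_inj e.
by rewrite e ltnn in xy.
Qed.

(* The pigeonhole principle supplies the third term of a decreasing sequence. *)
Lemma Av321_mono : mono_on t A.
Proof.
move=> x y; rewrite !finset.in_set => xA yA xy; rewrite ltnNge; apply/negP.
move=> /(perm_lt_neq xy) yx.
suff [k yk ky] : exists2 k : 'I_n, y < k & t k < t y by exact: (Av321P xy yk ky yx).
apply: contrapT => H.
(* Otherwise the [t y] smallest values all sit at positions before [y] other than [x]. There are
   only y - 1 of these, while [y <= t y]. *)
have sub : [set k : 'I_n | t k < t y]%SET \subset ([set k : 'I_n | k < y] :\ x)%SET.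
  apply/fintype.subsetP => k; rewrite !finset.inE => ky.
  apply/andP; split; first by apply: contraTneq ky => ->; rewrite -leqNgt ltnW.
  rewrite ltnNge leq_eqVlt; apply/negP => /orP[/eqP/val_inj e|yk].
    by rewrite e ltnn in ky.
  by apply: H; exists k.
have := subset_leq_card sub; rewrite card_perm_lt; last exact/ltnW.
have := cardsD1 x [set k : 'I_n | k < y]%SET.
rewrite card_ord_lt ?(ltnW (ltn_ord y))// (_ : x \in _ = true) ?finset.in_set//.
by move=> e /(leq_trans yA); rewrite {1}e ltnn.
Qed.

Lemma Av321_monoC : mono_on t (~: A).
Proof.
move=> x y; rewrite !finset.in_setC !finset.in_set -!ltnNge => xA yA xy.
rewrite ltnNge; apply/negP => /(perm_lt_neq xy) yx.
suff [k kx xk] : exists2 k : 'I_n, k < x & t x < t k by exact: (Av321P kx xy yx xk).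
apply: contrapT => H.
(* Otherwise the [x] positions before [x] all have values below [t x], while [t x < x]. *)
have sub : [set k : 'I_n | k < x]%SET \subset [set k : 'I_n | t k < t x]%SET.
  apply/fintype.subsetP => k; rewrite !finset.inE => kx.
  by rewrite ltnNge; apply/negP => /(perm_lt_neq kx) xk; apply: H; exists k.
have := subset_leq_card sub.
by rewrite card_ord_lt ?card_perm_lt//; [lia| |]; exact/ltnW.
Qed.

End avoiding_word.

(** The word gives back the weak exceedances and their values, and an avoiding permutation is
    increasing on them and on their complement. *)
Lemma card_Av321_le n : #|Av321 n| <= size (dycks n).
Proof.
rewrite cardE -(size_map (@word_of_perm n)); apply: uniq_leq_size; last first.
  by move=> _ /mapP[t + ->]; rewrite mem_enum; move=> _; exact: word_of_perm_dyck.
rewrite map_inj_in_uniq ?enum_uniq// => t u; rewrite !mem_enum => tA uA e.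
have eP := excs_word t; rewrite e excs_word in eP.
apply: (mono_on_inj (Av321_mono tA) (Av321_monoC tA)); rewrite -?eP.
- exact: Av321_mono.
- exact: Av321_monoC.
- by have := vals_word t; rewrite e vals_word eP => ->.
Qed.

(** * Windows of avoiding permutations *)

Definition window_labels (h : nat) (a : seq bool) (x : int) : bool :=
  nth false a (absz (x + h%:Z)%R).

Definition cylinder (h : nat) (U : set rooted_perm) :=
  forall x y, rp_restr h x = rp_restr h y -> U x -> U y.

(** The window starts at position [i], so the root is [i + h] and has entry [h] of the labels.
    Positions with equal labels compare by monotonicity, the others by [matching_high]. *)
Lemma rp_restr_matching n (s : seq bool) (t : 'S_n.+1) h i : s \in dycks n.+1 ->
  avoiding_match s t -> high (8 * h).+1 i s ->
  i + h <= n /\ rp_restr h (rp_of_perm t (inord (i + h))) =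
  rp_restr h (rp321 (window_labels h (labels h.*2.+1 i s))).
Proof.
move=> sD m hi; have [sn _ _] := dycksP _ _ sD.
(* The descent to 0 needs at least 8 h + 1 letters, so the whole window fits in the permutation. *)
have iN : i.*2 + (8 * h).+1 <= n.+1.*2.
  move: sD hi; rewrite mem_paths /high -{1}(cat_take_drop i.*2 s) run_cat.
  case: (run 0 _) => //= k /andP[/eqP/run_count e _] hk.
  by have := count_negb (drop i.*2 s); rewrite size_drop sn; lia.
have ihn : i + h <= n by lia.
have pos (x : int) : (`|x| <= h%:Z)%R -> (absz (x + (i + h)%:Z)%R < n.+1)%N by lia.
split=> //; apply/rp_restrP; split=> [a ha|a b ha hb].
  by rewrite /= /perm_dom /= inordK //; split=> // _; lia.
rewrite /= /perm_le inordK// le321E.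
have -> : (0 <= a + (i + h)%:Z <= n%:Z)%R by lia.
have -> : (0 <= b + (i + h)%:Z <= n%:Z)%R by lia.
pose j : 'I_n.+1 := inord (absz (a + (i + h)%:Z)%R).
pose k : 'I_n.+1 := inord (absz (b + (i + h)%:Z)%R).
have jE : ((j : nat)%:Z = a + (i + h)%:Z)%R by rewrite inordK; lia.
have kE : ((k : nat)%:Z = b + (i + h)%:Z)%R by rewrite inordK; lia.
have lE (x : int) (y : 'I_n.+1) : (`|x| <= h%:Z)%R -> ((y : nat)%:Z = x + (i + h)%:Z)%R ->
    window_labels h (labels h.*2.+1 i s) x = (y \in excs n.+1 s).
  move=> hx yE; rewrite /window_labels nth_mkseq; last by lia.
  by rewrite finset.in_set; congr (nth _ _ _.*2); lia.
rewrite /= -/j -/k (lE a j)// (lE b k)//.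
have [mP mC _] := m.
have cmp (A : {set 'I_n.+1}) : mono_on t A -> j \in A -> k \in A ->
    (t j <= t k)%N = (a <= b)%R.
  move=> mA jA kA; apply/idP/idP => [tjk|ab].
    rewrite leNgt; apply/negP => ba.
    have kj : (k < j)%N by lia.
    by have := mA k j kA jA kj; rewrite ltnNge tjk.
  have [e|ne] := eqVneq j k; first by rewrite e.
  have jk : (j < k)%N.
    by rewrite ltn_neqAle; apply/andP; split; [apply: contra_neq ne => /val_inj|lia].
  exact/ltnW/mA.
case: (boolP (j \in excs n.+1 s)) => jP; case: (boolP (k \in excs n.+1 s)) => kP /=.
- exact: cmp mP jP kP.
- by apply/negbTE; rewrite -ltnNge; apply: (matching_high sD m hi) => //; lia.
- by apply/ltnW; apply: (matching_high sD m hi) => //; lia.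
- by apply: cmp mC _ _; rewrite finset.in_setC.
Qed.

Local Open Scope classical_set_scope.
Local Open Scope ring_scope.

(** * Label statistics of uniform Dyck words *)

Section sums.
Variable R : realFieldType.

Lemma natr_count (T : Type) (a : pred T) (r : seq T) :
  \sum_(x <- r) (a x)%:R = (count a r)%:R :> R.
Proof. by elim: r => [|x r IH]; rewrite ?big_nil// big_cons IH /= natrD. Qed.

Lemma sum_swap K i n a b (f : seq bool -> R) :
  (i.*2 <= a < i.*2 + K)%N -> (i.*2 <= b < i.*2 + K)%N ->
  \sum_(s <- hdycks K i n) f (swap a b s) = \sum_(s <- hdycks K i n) f s.
Proof.
move=> ha hb; rewrite -(big_map (swap a b) xpredT f); apply: perm_big.
have H s := @swap_hdycks K i n a b s ha hb.
have u : uniq (hdycks K i n) by rewrite filter_uniq ?paths_uniq.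
have u' : uniq [seq swap a b s | s <- hdycks K i n].
  rewrite map_inj_in_uniq// => s t /H[sa sb _] /H[ta tb _].
  by move=> /(congr1 (swap a b)); rewrite !swapK.
have sub : {subset [seq swap a b s | s <- hdycks K i n] <= hdycks K i n}.
  by move=> _ /mapP[s /H[_ _ ?] ->].
by apply: uniq_perm => //; have [|_ e] := uniq_min_size u' sub;
  rewrite ?size_map// => x; rewrite e.
Qed.

Definition sgn (s : seq bool) (p : nat) : R := if nth false s p then 1 else -1.

Lemma sgn_sqr s p : sgn s p * sgn s p = 1.
Proof. by rewrite /sgn; case: nth; rewrite ?mulrNN mulr1. Qed.

Lemma sgn_swap K i n a b s x :
  (i.*2 <= a < i.*2 + K)%N -> (i.*2 <= b < i.*2 + K)%N ->
  s \in hdycks K i n -> sgn (swap a b s) x = sgn s (transp a b x).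
Proof. by move=> ha hb /(swap_hdycks ha hb)[sa sb _]; rewrite /sgn nth_swap. Qed.

Let nlow K i n := (count (predC (high K i)) (dycks n))%:R : R.

(* By exchangeability any two letters are correlated as the first two, which are
   UD in at least a quarter of the words, up to the low ones. *)
Lemma sum_hdycks_corr K i n j k :
  (i < n)%N -> (j < K)%N -> (k < K)%N -> j != k ->
  \sum_(s <- hdycks K i n) sgn s (i.*2 + j) * sgn s (i.*2 + k) <=
  4 * nlow K i n.
Proof.
move=> lin jK kK jk.
have K1 : (1 < K)%N by lia.
have w0 x : (x < K)%N -> (i.*2 <= i.*2 + x < i.*2 + K)%N by lia.
have -> : \sum_(s <- hdycks K i n) sgn s (i.*2 + j) * sgn s (i.*2 + k) =
    \sum_(s <- hdycks K i n) sgn s i.*2 * sgn s i.*2.+1.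
  (* One swap brings [j] to the first letter of the window, a second one brings [k] to the next. *)
  wlog j0 : j k jK kK jk / j = 0%N.
    move=> WL; have [j0|jN0] := eqVneq j 0%N; first exact: WL.
    have [k0|kN0] := eqVneq k 0%N.
      by under eq_bigr do rewrite mulrC; apply: WL; rewrite // eq_sym.
    rewrite -(WL 0%N k _ kK) //; [|lia|by rewrite eq_sym].
    have h0 := w0 0%N (ltnW K1); rewrite -(sum_swap _ _ h0 (w0 j jK)).
    apply: eq_big_seq => s sG; rewrite !(sgn_swap _ h0 (w0 j jK) sG) /transp.
    rewrite !eqn_add2l (negbTE kN0) (negbTE jN0) eqxx eq_sym (negbTE jk).
    by [].
  subst j; rewrite addn0.
  have [->|k1] := eqVneq k 1%N; first by rewrite addn1.
  rewrite -(sum_swap _ _ (w0 k kK) (w0 1%N K1)).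
  apply: eq_big_seq => s sG; rewrite !(sgn_swap _ (w0 k kK) (w0 1%N K1) sG) /transp.
  rewrite -[X in (X == i.*2 + k)%N]addn0 eqn_add2l (negbTE jk).
  by rewrite eqxx addn1 eqn_leq ltnn andbF.
have w2 := w0 0%N (ltnW K1); have w1 := w0 1%N K1.
pose ud s : bool := nth false s i.*2 && ~~ nth false s i.*2.+1.
pose du s : bool := ~~ nth false s i.*2 && nth false s i.*2.+1.
have Esgn s : sgn s i.*2 * sgn s i.*2.+1 = 1 - 2 * (ud s)%:R - 2 * (du s)%:R.
  by rewrite /sgn /ud /du; do 2!case: nth; rewrite /=; lra.
(* Swapping the first two letters exchanges UD and DU, so both are equally frequent and opposite
   signs occur in at least half of the words, up to low ones. *)
have cu : \sum_(s <- hdycks K i n) (du s)%:R = \sum_(s <- hdycks K i n) (ud s)%:R :> R.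
  rewrite -(sum_swap _ _ w2 w1); apply: eq_big_seq => s /(swap_hdycks w2 w1)[sa sb _].
  rewrite /du /ud !nth_swap// /transp addn0 addn1 !eqxx.
  by rewrite andbC -[X in (X == _)%N]addn1 -[X in (_ == X)%N]addn0 eqn_add2l.
under eq_bigr do rewrite Esgn.
rewrite !sumrB -!mulr_sumr cu.
have -> : \sum_(s <- hdycks K i n) (1 : R) = (size (dycks n))%:R - nlow K i n.
  rewrite big_const_seq iter_addr_0 count_predT size_filter /nlow.
  by rewrite -(count_predC (high K i) (dycks n)) natrD addrK.
rewrite natr_count; have := size_le_updown K lin.
rewrite -/ud -(ler_nat R) natrM natrD -/(nlow K i n) -/(hdycks K i n) => H.
have : 0 <= nlow K i n by [].
lra.
Qed.

(** Expanding the square leaves [M] diagonal terms equal to 1 per word; the others are bounded by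
    [sum_hdycks_corr]. *)
Lemma sum_hdycks_sqr K i n c M : (i < n)%N -> (c + M <= K)%N ->
  \sum_(s <- hdycks K i n) (\sum_(j < M) sgn s (i.*2 + (c + j))) ^+ 2 <=
  M%:R * (size (dycks n))%:R + M%:R ^+ 2 * (4 * nlow K i n).
Proof.
move=> lin cM.
under eq_bigr do rewrite expr2 big_distrlr /=.
rewrite exchange_big /=.
have -> : M%:R * (size (dycks n))%:R + M%:R ^+ 2 * (4 * nlow K i n) =
    \sum_(j < M) ((size (dycks n))%:R + \sum_(k < M) (4 * nlow K i n)) :> R.
  move: (nlow _ _ _) (size _) => l d.
  rewrite !sumr_const card_ord expr2 -mulrA mulrnDl.
  by rewrite !(mulr_natl _ M).
apply: ler_sum => j _; rewrite exchange_big /= (bigD1 j)//= [in leRHS](bigD1 j)//= addrA.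
have n0 : 0 <= nlow K i n by [].
apply: lerD.
  under eq_bigr do rewrite sgn_sqr.
  rewrite big_const_seq iter_addr_0 count_predT.
  apply: ler_wpDr; first by rewrite mulr_ge0.
  by rewrite ler_nat size_filter count_size.
apply: ler_sum => k kj; apply: sum_hdycks_corr => //.
- by have := ltn_ord j; lia.
- by have := ltn_ord k; lia.
- by rewrite eqn_add2l eq_sym.
Qed.

(* Exchangeability replaces the sign by its average over [t ^ 2] letters, whose
   sum [S] is bounded through [2 |S| <= S^2 / t + t]. *)
Lemma sum_sgn_hdycks t c K i n (f : seq bool -> R) :
  (0 < t)%N -> (i < n)%N -> (c + t ^ 2 <= K)%N -> (forall s, `|f s| <= 1) ->
  (forall j s, (j < t ^ 2)%N -> s \in hdycks K i n ->
     f (swap (i.*2 + c) (i.*2 + (c + j)) s) = f s) ->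
  `|\sum_(s <- hdycks K i n) f s * sgn s (i.*2 + c)| <=
  (size (dycks n))%:R / t%:R + 2 * t%:R * nlow K i n.
Proof.
move=> t0 lin cK f1 fsw; set M := (t ^ 2)%N in cK fsw.
pose S s := \sum_(j < M) sgn s (i.*2 + (c + j)).
have M0 : (0 < M)%N by rewrite expn_gt0 t0.
have tR : 0 < t%:R :> R by rewrite ltr0n.
have MR : M%:R = t%:R ^+ 2 :> R by rewrite natrX.
have w x : (x < M)%N -> (i.*2 <= i.*2 + (c + x) < i.*2 + K)%N by lia.
(* Since [f] is invariant under the swaps, each of the [M] letters yields the same sum against
   [f]. *)
have A : M%:R * (\sum_(s <- hdycks K i n) f s * sgn s (i.*2 + c)) =
    \sum_(s <- hdycks K i n) f s * S s.
  under [in RHS]eq_bigr do rewrite mulr_sumr.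
  rewrite exchange_big /= -[in LHS](card_ord M) mulr_natl -sumr_const.
  apply: eq_bigr => j _; have wj := w j (ltn_ord j); have w0 := w 0%N M0.
  rewrite addn0 in w0; rewrite -(sum_swap _ _ w0 wj).
  apply: eq_big_seq => s sG; rewrite fsw// (sgn_swap _ w0 wj sG) /transp eqxx.
  by [].
have B : \sum_(s <- hdycks K i n) `|S s| <=
    (\sum_(s <- hdycks K i n) (S s) ^+ 2) / t%:R / 2 + t%:R / 2 * (size (dycks n))%:R.
  apply: (@le_trans _ _ (\sum_(s <- hdycks K i n) ((S s) ^+ 2 / t%:R / 2 + t%:R / 2))).
    apply: ler_sum => s _; rewrite -[(S s) ^+ 2]real_normK ?num_real//.
    set x := `|S s|; rewrite -subr_ge0.
    have -> : x ^+ 2 / t%:R / 2 + t%:R / 2 - x = (x - t%:R) ^+ 2 / t%:R / 2.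
      have tt : t%:R * t%:R^-1 = 1 :> R by rewrite mulfV ?gt_eqF.
      have e1 : x * t%:R / t%:R = x by rewrite mulfK ?gt_eqF.
      have e2 : t%:R ^+ 2 / t%:R = t%:R :> R by rewrite expr2 mulfK ?gt_eqF.
      rewrite sqrrB; lra.
    by rewrite !divr_ge0 ?sqr_ge0// ltW.
  rewrite big_split /= -!mulr_suml lerD2l big_const_seq iter_addr_0 count_predT.
  by rewrite -[_ *+ size _]mulr_natr mulrAC ler_wpM2l ?divr_ge0 ?ler_nat
    ?(size_filter (high _ _)) ?count_size.
have C := sum_hdycks_sqr lin cK.
have D : M%:R * `|\sum_(s <- hdycks K i n) f s * sgn s (i.*2 + c)| <=
    \sum_(s <- hdycks K i n) `|S s|.
  rewrite -{1}[M%:R]ger0_norm// -normrM A; apply: le_trans (ler_norm_sum _ _ _) _.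
  by apply: ler_sum => s _; rewrite normrM ler_piMl.
have MR0 : 0 < M%:R :> R by rewrite ltr0n.
suff : M%:R * `|\sum_(s <- hdycks K i n) f s * sgn s (i.*2 + c)| <=
  M%:R * ((size (dycks n))%:R / t%:R + 2 * t%:R * nlow K i n) by rewrite ler_pM2l.
apply: (le_trans D); apply: (le_trans B).
have -> : M%:R * ((size (dycks n))%:R / t%:R + 2 * t%:R * nlow K i n) =
  (M%:R * (size (dycks n))%:R + M%:R ^+ 2 * (4 * nlow K i n)) / t%:R / 2 +
  t%:R / 2 * (size (dycks n))%:R.
  move: (nlow _ _ _) (size _) => l d; rewrite MR.
  have tN : t%:R != 0 :> R by rewrite gt_eqF.
  have e1 : t%:R ^+ 2 / t%:R = t%:R :> R by rewrite expr2 mulfK.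
  rewrite [X in _ = X / 2 + _](_ : _ = t%:R * d%:R + t%:R ^+ 3 * (4 * l)); last first.
    have e2 : (t%:R ^+ 2) ^+ 2 / t%:R = t%:R ^+ 3 :> R.
      by rewrite -exprM -[(2 * 2)%N]/4%N exprSr mulfK.
    by rewrite mulrDl (mulrAC _ d%:R) e1 (mulrAC _ (4 * l)) e2.
  by rewrite [LHS]mulrDr (mulrCA (_ ^+ 2) d%:R) e1; lra.
by rewrite lerD2r !ler_pM2r ?invr_gt0.
Qed.

Lemma sum_sgn_dycks t c K i n (f : seq bool -> R) :
  (0 < t)%N -> (i < n)%N -> (c + t ^ 2 <= K)%N -> (forall s, `|f s| <= 1) ->
  (forall j s, (j < t ^ 2)%N -> s \in hdycks K i n ->
     f (swap (i.*2 + c) (i.*2 + (c + j)) s) = f s) ->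
  `|\sum_(s <- dycks n) f s * sgn s (i.*2 + c)| <=
  (size (dycks n))%:R / t%:R + (2 * t%:R + 1) * nlow K i n.
Proof.
move=> t0 lin cK f1 fsw.
rewrite (bigID (high K i)) /= -big_filter mulrDl addrA mul1r.
apply: le_trans (ler_normD _ _) _; apply: lerD; first exact: sum_sgn_hdycks.
apply: le_trans (ler_norm_sum _ _ _) _.
rewrite /nlow -natr_count big_mkcond /=; apply: ler_sum => s _; case: ifP => //= _.
by rewrite normrM /sgn; case: nth; rewrite ?normrN normr1 mulr1.
Qed.

(** As [f i] only reads letters before 2 i + c, swaps of later letters fix it. The low words of all
    roots together are bounded by [count_low_heights]. *)
Lemma sum_label_diff t c n (f : nat -> seq bool -> R) :
  (0 < t)%N -> (forall i s, `|f i s| <= 1) ->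
  (forall i s s', (forall x, (x < i.*2 + c)%N -> nth false s x = nth false s' x) ->
     f i s = f i s') ->
  `|\sum_(i < n) \sum_(s <- dycks n) f i s * sgn s (i.*2 + c)| <=
  (size (dycks n))%:R * (n%:R / t%:R +
     (2 * t%:R + 1) * (\sum_(k < c + t ^ 2) 4 ^ k.+1)%:R).
Proof.
move=> t0 f1 floc; apply: le_trans (ler_norm_sum _ _ _) _.
apply: (@le_trans _ _ (\sum_(i < n) ((size (dycks n))%:R / t%:R +
   (2 * t%:R + 1) * nlow (c + t ^ 2) i n))).
  apply: ler_sum => i _; apply: sum_sgn_dycks => // j s jt sG; apply: floc => x xc.
  have w k : (k < t ^ 2)%N -> (i.*2 <= i.*2 + (c + k) < i.*2 + (c + t ^ 2))%N by lia.
  have w0 := w 0%N (leq_ltn_trans (leq0n _) jt); rewrite addn0 in w0.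
  have [sa sb _] := swap_hdycks w0 (w j jt) sG.
  rewrite nth_swap// /transp !ifF//; apply/negbTE; rewrite neq_ltn; apply/orP; left; lia.
rewrite big_split /= sumr_const card_ord -mulr_sumr mulrDr.
apply: lerD; first by rewrite -[_ *+ n]mulr_natr mulrAC mulrA.
rewrite mulrCA ler_wpM2l ?addr_ge0 ?mulr_ge0//.
by rewrite -natr_sum -natrM ler_nat mulnC count_low_heights.
Qed.

End sums.

(** * Limiting frequencies of label words *)

Section frequencies.
Variable R : realType.

(** The probability of [A] for a uniform root in an independent uniform Dyck word; at [n = 0] the
    value is 0. *)
Definition freq n (A : nat -> pred (seq bool)) : R :=
  (\sum_(i < n) \sum_(s <- dycks n) (A i s)%:R) / (n%:R * (size (dycks n))%:R).

(** The next label is the letter 2 i + 2 |a|, and the labels in [a] are read before it, so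
    [sum_label_diff] applies. *)
Lemma freq_label_diff (a : seq bool) :
  (fun n => freq n (fun i s => labels (size a).+1 i s == rcons a true) -
            freq n (fun i s => labels (size a).+1 i s == rcons a false)) @ \oo --> (0 : R).
Proof.
pose f i s : R := (labels (size a) i s == a)%:R.
have E n : freq n (fun i s => labels (size a).+1 i s == rcons a true) -
            freq n (fun i s => labels (size a).+1 i s == rcons a false) =
  (\sum_(i < n) \sum_(s <- dycks n) f i s * sgn R s (i.*2 + (size a).*2)) /
  (n%:R * (size (dycks n))%:R).
  rewrite /freq -mulrBl -sumrB; congr (_ / _); apply: eq_bigr => i _.
  rewrite -sumrB; apply: eq_bigr => s _; rewrite labelsS doubleD /f /sgn.
  by rewrite !eqseq_rcons; case: eqP => _; case: nth; rewrite /= ?mul0r ?subr0 ?sub0r ?mul1r.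
under eq_fun do rewrite E.
apply/cvgr0Pnorm_le => e e0.
(* With this [t] the term 1/t is at most e/2; then [C] is fixed, and C/n is below e/2 for large
   [n]. *)
pose t := (Num.truncn (2 / e)).+1.
pose C : R := (2 * t%:R + 1) * (\sum_(k < (size a).*2 + t ^ 2) 4 ^ k.+1)%N%:R.
near=> n.
have n0 : (0 : R) < n%:R by rewrite ltr0n; near: n; exact: nbhs_infty_gt.
have nC : C / (e / 2) < n%:R by near: n; exact: nbhs_infty_gtr.
have d0 : (0 : R) < (size (dycks n))%:R by rewrite ltr0n size_dycks_gt0.
have t0 : (0 : R) < t%:R by [].
have te : (t%:R)^-1 <= e / 2.
  rewrite -[e / 2]invrK lef_pV2 ?posrE ?invr_gt0 ?divr_gt0// invf_div ltW//.
  exact: truncnS_gt.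
have nd0 : 0 < n%:R * (size (dycks n))%:R :> R by rewrite mulr_gt0.
rewrite normf_div (gtr0_norm nd0).
rewrite ler_pdivrMr//.
apply: le_trans (@sum_label_diff R t (size a).*2 n f _ _ _) _ => //.
- by move=> i s; rewrite /f ger0_norm// lern1 leq_b1.
- move=> i s s' ss'; rewrite /f; congr (_ == _)%:R.
  apply/eq_in_map => j; rewrite mem_iota /= add0n => ja.
  by apply: ss'; lia.
rewrite -/C mulrC mulrA ler_pM2r// [X in _ <= X * _](splitr e) mulrDl.
apply: lerD; first by rewrite mulrC ler_pM2r.
by rewrite mulrC ltW// -ltr_pdivrMr// divr_gt0.
Unshelve. all: by end_near. Qed.

Lemma freq_labels_rcons (a : seq bool) n :
  freq n (fun i s => labels (size a).+1 i s == rcons a true) +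
  freq n (fun i s => labels (size a).+1 i s == rcons a false) =
  freq n (fun i s => labels (size a) i s == a).
Proof.
rewrite /freq -mulrDl -big_split /=; congr (_ / _); apply: eq_bigr => i _.
rewrite -big_split; apply: eq_bigr => s _; rewrite labelsS.
by rewrite !eqseq_rcons; case: eqP => _; case: nth; rewrite /= ?addr0 ?add0r.
Qed.

(** The two one-letter extensions of a word share its frequency and differ by o(1), so each tends to
    half of its limit. *)
Lemma label_freq (a : seq bool) :
  freq n (fun i s => labels (size a) i s == a) @[n --> \oo] --> (2 ^- size a : R).
Proof.
elim/last_ind: a => [|a b IH].
  apply: cvg_near_cst; near=> n.
  have n0 : (0 : R) < n%:R by rewrite ltr0n; near: n; exact: nbhs_infty_gt.
  have d0 : (0 : R) < (size (dycks n))%:R by rewrite ltr0n size_dycks_gt0.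
  rewrite /freq /labels /= expr0 invr1.
  under eq_bigr do rewrite big_const_seq iter_addr_0 count_predT.
  by rewrite sumr_const card_ord -[_ *+ n]mulr_natl divff// mulf_neq0 ?gt_eqF.
have D := freq_label_diff a.
have half (u v w : nat -> R) (l : R) : (forall n, u n = (v n + w n) / 2) ->
    v @ \oo --> l -> w @ \oo --> 0 -> u @ \oo --> (l / 2).
  move=> uE vl w0; rewrite (_ : u = (fun n => (v n + w n) / 2)); last exact/funext.
  by apply: cvgMl; rewrite -[l]addr0; apply: cvgD.
rewrite size_rcons exprS invfM mulrC; case: b.
  by apply: (half _ _ _ _ _ IH D) => n; rewrite -freq_labels_rcons; lra.
have ND : (fun n => - (freq n (fun i s => labels (size a).+1 i s == rcons a true) -
    freq n (fun i s => labels (size a).+1 i s == rcons a false))) @ \oo --> (0 : R).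
  by rewrite -oppr0; exact: cvgN.
by apply: (half _ _ _ _ _ IH ND) => n; rewrite -freq_labels_rcons; lra.
Unshelve. all: by end_near. Qed.

Lemma freq_labels_pred (w : nat) (Q : pred (seq bool)) n :
  freq n (fun i s => Q (labels w i s)) =
  \sum_(a <- words w | Q a) freq n (fun i s => labels (size a) i s == a).
Proof.
rewrite /freq -mulr_suml; congr (_ / _); rewrite [RHS]exchange_big; apply: eq_bigr => i _.
rewrite [RHS]exchange_big; apply: eq_bigr => s _ /=.
have lw : labels w i s \in words w by rewrite mem_words size_mkseq.
rewrite big_mkcond (bigD1_seq _ lw (words_uniq w)) /= size_mkseq eqxx.
rewrite big1_seq ?addr0; first by case: (Q _).
move=> a /andP[la]; rewrite mem_words => /eqP ->.
by rewrite eq_sym (negbTE la) if_same.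
Qed.

Lemma freq_low K : freq n (fun i s => ~~ high K i s) @[n --> \oo] --> (0 : R).
Proof.
apply/cvgr0Pnorm_le => e e0.
pose C : R := (\sum_(k < K) 4 ^ k.+1)%N%:R.
near=> n.
have n0 : (0 : R) < n%:R by rewrite ltr0n; near: n; exact: nbhs_infty_gt.
have nC : C / e < n%:R by near: n; exact: nbhs_infty_gtr.
have d0 : (0 : R) < (size (dycks n))%:R by rewrite ltr0n size_dycks_gt0.
have nd0 : 0 < n%:R * (size (dycks n))%:R :> R by rewrite mulr_gt0.
rewrite normf_div (gtr0_norm nd0) ler_pdivrMr// ger0_norm; last first.
  by apply: sumr_ge0 => i _; apply: sumr_ge0.
under eq_bigr do rewrite natr_count.
rewrite -natr_sum; apply: le_trans (_ : C * (size (dycks n))%:R <= _).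
  by rewrite -natrM ler_nat; exact: count_low_heights.
by rewrite mulrA ler_pM2r// mulrC ltW// -ltr_pdivrMr.
Unshelve. all: by end_near. Qed.

(** Requiring height at least [K] costs no more than the frequency of low roots, which tends to
    0. *)
Lemma freq_high_labels K w (Q : pred (seq bool)) :
  freq n (fun i s => high K i s && Q (labels w i s)) @[n --> \oo] -->
  ((count Q (words w))%:R / 2 ^+ w : R).
Proof.
have cQ : freq n (fun i s => Q (labels w i s)) @[n --> \oo] -->
    ((count Q (words w))%:R / 2 ^+ w : R).
  under eq_fun do rewrite freq_labels_pred.
  rewrite (_ : _ / _ = \sum_(a <- words w | Q a) 2 ^- size a); last first.
    rewrite -natr_count mulr_suml [RHS]big_mkcond; apply: eq_big_seq => a.
    by rewrite mem_words => /eqP ->; case: (Q a); rewrite ?mul1r ?mul0r.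
  have sum_cons (r : seq (seq bool)) a (F : seq bool -> R) :
      \sum_(x <- a :: r | Q x) F x = (if Q a then F a else 0) + \sum_(x <- r | Q x) F x.
    by rewrite big_cons; case: (Q a); rewrite ?add0r.
  suff H (r : seq (seq bool)) :
      \sum_(a <- r | Q a) freq n (fun i s => labels (size a) i s == a) @[n --> \oo]
      --> (\sum_(a <- r | Q a) 2 ^- size a : R) by exact: H.
  elim: r => [|a r IH].
    rewrite [X in _ --> X]big_nil; under eq_fun do rewrite big_nil; exact: cvg_cst.
  rewrite [X in _ --> X]sum_cons; under eq_fun do rewrite sum_cons.
  by apply: cvgD => //; case: (Q a); [exact: label_freq|exact: cvg_cst].
have le (A B : nat -> pred (seq bool)) n : (forall i s, A i s -> B i s) -> freq n A <= freq n B.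
  move=> AB; rewrite /freq ler_wpM2r// ?invr_ge0 ?mulr_ge0//.
  by apply: ler_sum => i _; apply: ler_sum => s _; rewrite ler_nat; case: (A i s) (AB i s) => // ->.
apply: (@squeeze_cvgr _ _ _ _ (fun n => freq n (fun i s => Q (labels w i s)) -
   freq n (fun i s => ~~ high K i s)) (fun n => freq n (fun i s => Q (labels w i s)))) => //.
  apply: nearW => n; apply/andP; split; last by apply: le => i s /andP[].
  rewrite lerBlDr /freq -mulrDl ler_wpM2r// ?invr_ge0 ?mulr_ge0// -big_split.
  apply: ler_sum => i _; rewrite -big_split; apply: ler_sum => s _ /=.
  by case: (high _ _ _) => /=; case: (Q _); rewrite ?addr0 ?add0r.
by rewrite -[X in _ --> X]subr0; apply: cvgB => //; exact: freq_low.
Qed.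

End frequencies.

(** * From Dyck words to masses of uniform avoiding permutations *)

Section mass.
Variable R : realType.

Definition root_mass n (U : set rooted_perm) (t : 'S_n.+1) : R :=
  n.+1%:R^-1 * \sum_(k < n.+1) (`[< U (rp_of_perm t k) >])%:R.

(** The words match distinct avoiding permutations, and each high root [i] gives the root [i + h]
    with the same window. Dropping low roots, and having no more permutations than words, both go in
    the direction of the inequality. *)
Lemma freq_le_root_mass n h U : cylinder h U ->
  freq R n.+1 (fun i s => high (8 * h).+1 i s &&
     `[< U (rp321 (window_labels h (labels h.*2.+1 i s))) >]) <=
  #|Av321 n.+1|%:R^-1 * \sum_(t in Av321 n.+1) root_mass U t.
Proof.
move=> cU.
have [psi psiP] : exists psi : seq bool -> 'S_n.+1,
    forall s, s \in dycks n.+1 -> avoiding_match s (psi s).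
  have H s : exists t : 'S_n.+1, s \in dycks n.+1 -> avoiding_match s t.
    have [sD|sD] := boolP (s \in dycks n.+1); last by exists 1%g.
    by have [t ?] := matching_exists sD; exists t.
  by have [f Hf] := choice H; exists f.
have card0 : (0 < #|Av321 n.+1|)%N.
  apply/card_gt0P; have : has predT (dycks n.+1) by rewrite has_predT size_dycks_gt0.
  case/hasP => s sD _; exists (psi s); exact: matching_Av321 sD (psiP _ sD).
pose F t k : R := (`[< U (rp_of_perm t (inord k : 'I_n.+1)) >])%:R.
pose g t : R := \sum_(k < n.+1) F t k.
have F0 t k : 0 <= F t k by [].
have g0 t : 0 <= g t by apply: sumr_ge0.
have massE t : root_mass U t = n.+1%:R^-1 * g t.
  by congr (_ * _); apply: eq_bigr => k _; rewrite /F inord_val.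
under eq_bigr do rewrite massE.
rewrite -mulr_sumr mulrA -invfM /freq [leLHS]mulrC.
have step1 s : s \in dycks n.+1 -> \sum_(i < n.+1) (high (8 * h).+1 i s &&
     `[< U (rp321 (window_labels h (labels h.*2.+1 i s))) >])%:R <= g (psi s).
  (* Extension by 0 past the last root allows the shift of the index by [h]. *)
  move=> sD; pose G k := if (k < n.+1)%N then F (psi s) k else 0.
  apply: (@le_trans _ _ (\sum_(0 <= i < n.+1) G (i + h)%N)).
    rewrite big_mkord; apply: ler_sum => i _.
    have [hi|_] := boolP (high _ _ _); last by rewrite /G; case: ifP.
    have [ih e] := rp_restr_matching sD (psiP _ sD) hi.
    rewrite /G ltnS ih /F /= ler_nat; case: asboolP => // Ul.
    by case: asboolP => // nU; exfalso; apply: nU; apply: cU Ul.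
  have -> : \sum_(0 <= i < n.+1) G (i + h)%N = \sum_(h <= i < n.+1 + h) G i.
    by rewrite -{2}[h]add0n big_addn addnK.
  apply: (@le_trans _ _ (\sum_(0 <= i < n.+1 + h) G i)).
    rewrite [leRHS](big_cat_nat (n := h))//=; last by rewrite leq_addl.
    by rewrite lerDr; apply: sumr_ge0 => k _; rewrite /G; case: ifP.
  rewrite (big_cat_nat (n := n.+1))//=; last by rewrite leq_addr.
  rewrite [X in _ + X]big_nat_cond [X in _ + X]big1 ?addr0; last first.
    by move=> k /andP[/andP[nk _] _]; rewrite /G ltnNge nk.
  rewrite big_mkord; apply: ler_sum => k _; rewrite /G ltn_ord//.
have step2 : \sum_(s <- dycks n.+1) g (psi s) <= \sum_(t in Av321 n.+1) g t.
  rewrite -(big_map psi xpredT g) big_uniq /=; last first.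
    rewrite map_inj_in_uniq ?paths_uniq// => s s' sD sD' e.
    by apply: (matching_inj sD sD' (psiP _ sD)); rewrite e; exact: psiP.
  rewrite big_mkcond [leRHS]big_mkcond /=; apply: ler_sum => t _.
  case: ifPn => [/mapP[s sD ->]|_]; last by case: ifP.
  by rewrite (matching_Av321 sD (psiP _ sD)).
have step3 : \sum_(i < n.+1) \sum_(s <- dycks n.+1) (high (8 * h).+1 i s &&
     `[< U (rp321 (window_labels h (labels h.*2.+1 i s))) >])%:R <=
     \sum_(t in Av321 n.+1) g t.
  rewrite exchange_big /=; apply: le_trans step2.
  by rewrite big_seq [leRHS]big_seq; apply: ler_sum => s; exact: step1.
apply: ler_pM => //.
  by apply: sumr_ge0 => i _; apply: sumr_ge0.
rewrite mulrC lef_pV2 ?posrE ?mulr_gt0 ?ltr0n ?size_dycks_gt0//.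
by rewrite ler_pM2r ?ltr0n// ler_nat card_Av321_le.
Qed.

End mass.

(** * Weak convergence and cylinders *)

Section cylinders.
Variable R : realType.
Local Notation S := (rooted_space R).

Lemma local_dist_lt (h : nat) (x y : rooted_perm) :
  local_dist R x y < 2 `^ (- h%:R) -> rp_restr h x = rp_restr h y.
Proof.
move=> d; apply: contrapT => nxy.
have : (agree_radius R x y <= h%:R%:E)%E.
  apply: agree_radius_le => k k0 xyk; rewrite lee_fin ler_nat leqNgt.
  by apply/negP => hk; apply: nxy; apply: rp_restr_le xyk; exact: ltnW.
have h0 : (0 <= h%:R%:E :> \bar R)%E by rewrite lee_fin.
by move=> /(pow2N_le (or_intror h0)); rewrite /= leNgt; move: d => /[swap] /negP.
Qed.

Lemma cylinder_open h (U : set S) : cylinder h U -> open U.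
Proof.
move=> cU; rewrite openE => x Ux; apply/nbhs_ballP.
exists (2 `^ (- h%:R)) => /=; first by rewrite powR_gt0.
by move=> y; rewrite ballEmdist /= => /local_dist_lt e; exact: cU Ux.
Qed.

Lemma cylinderC h (U : set rooted_perm) : cylinder h U -> cylinder h (~` U).
Proof. by move=> cU x y e nx Uy; apply: nx; apply: cU Uy. Qed.

Lemma cylinder_measurable h (U : set S) : cylinder h U -> measurable U.
Proof. by move=> /cylinder_open oU; exact: sub_sigma_algebra. Qed.

(** A cylinder and its complement are both open, so the indicator is locally constant. *)
Lemma cylinder_indic_continuous h (U : set S) : cylinder h U ->
  continuous (\1_U : S -> R).
Proof.
move=> cU x; apply: (@cvg_near_cst S R (\1_U x) (\1_U : S -> R) (nbhs x) _).
have [Ux|Ux] := pselect (U x).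
  have : nbhs x U by apply: open_nbhs_nbhs; split=> //; exact: cylinder_open cU.
  by apply: filterS => y Uy; rewrite !indicE !mem_set.
have : nbhs x (~` U).
  by apply: open_nbhs_nbhs; split=> //; exact: cylinder_open (cylinderC cU).
by apply: filterS => y Uy; rewrite !indicE !memNset.
Qed.

Lemma open_bigcup_cylinder (U : set S) : open U ->
  exists V : nat -> set S, [/\ forall h, cylinder h (V h),
    {homo V : n m / (n <= m)%N >-> n `<=` m} & U = \bigcup_h V h].
Proof.
move=> oU; exists (fun h => [set x : S | forall y, rp_restr h x = rp_restr h y -> U y]).
split.
- by move=> h x y e Hx z e'; apply: Hx; rewrite e.
- move=> n m nm x Hx y e; apply: Hx; exact: rp_restr_le e.
apply/seteqP; split=> [x Ux|x [h _ Hx]]; last exact: Hx.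
have /nbhs_ballP[e /= e0 eU] : nbhs x U by exact: open_nbhs_nbhs.
(* This gives 1/e < h < 2^h, so agreement on radius [h] forces a distance below [e]. *)
pose h := (Num.truncn e^-1).+1.
exists h => // y xy; apply: eU; rewrite ballEmdist /=.
apply: le_lt_trans (local_dist_le R _ xy) _ => //.
rewrite powRN powR_mulrn// -[ltRHS]invrK ltf_pV2 ?posrE ?invr_gt0 ?exprn_gt0//.
apply: lt_trans (truncnS_gt _) _.
by rewrite -natrX ltr_nat ltn_expl.
Qed.

(** The open sets are stable under intersection and generate the measurable sets; each is an
    increasing union of cylinders, so continuity from below applies. *)
Lemma probability_eq_cylinder (m1 m2 : probability S R) :
  (forall h (U : set S), cylinder h U -> m1 U = m2 U) ->
  forall B : set S, measurable B -> m1 B = m2 B.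
Proof.
move=> H; apply: (@measure_unique _ R S (@open S) (fun=> setT)) => //.
- by move=> A B oA oB; exact: openI.
- by move=> _; exact: openT.
- by apply/seteqP; split=> // x _; exists 0%N.
- move=> U oU; have [V [cV ndV UE]] := open_bigcup_cylinder oU.
  have c (m : probability S R) : (m \o V) n @[n --> \oo] --> m U.
    rewrite UE; apply: nondecreasing_cvg_mu.
    + by move=> h; exact: cylinder_measurable (cV h).
    + by rewrite -UE; exact: sub_sigma_algebra.
    + by move=> n k nk; apply/subsetPset; exact: ndV.
  have e : m1 \o V = m2 \o V by apply/funext => h /=; exact: H (cV h).
  have := c m1; rewrite e => c1.
  exact: (cvg_unique (@ereal_hausdorff R) c1 (c m2)).
- by move=> _ /=; rewrite probability_setT ltry.
Qed.

Definition mass (U : set S) (nu : pmeasure R) : R := fine ((nu : probability S R) U).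

(** The mass is the integral of a bounded continuous indicator, hence a coordinate of the map that
    defines the weak topology. *)
Lemma mass_continuous h (U : set S) : cylinder h U -> continuous (mass U).
Proof.
move=> cU; have b : exists M, forall x : S, `|\1_U x| <= M :> R.
  by exists 1 => x; rewrite ger0_norm// indicE lern1 leq_b1.
pose f : test_fun R := exist _ (\1_U : S -> R) (conj (cylinder_indic_continuous cU) b).
have -> : mass U = (fun g : {ptws test_fun R -> R} => g f) \o @test_integrals R.
  apply/funext => nu; rewrite /mass /= /test_integrals /Rintegral /=.
  by rewrite integral_indic ?setIT//; exact: cylinder_measurable cU.
move=> nu; apply: continuous_comp; first exact: initial_continuous.
exact: proj_continuous.
Qed.

End cylinders.

(** * Expectations over uniform permutations and the law of the labels *)

Lemma mass_mu_perm (R : realType) n (U : set (rooted_space R)) (t : 'S_n.+1) :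
  mass U (mu_perm R t) = root_mass R U t.
Proof.
have -> : root_mass R U t = fine (((n.+1%:R^-1)%:E *
    \sum_(k < n.+1) (`[< U (rp_of_perm t k) >]%:R : R)%:E)%E).
  by rewrite sumEFin -EFinM.
congr (fine (_ * _)%E); apply: eq_bigr => k _.
by rewrite /= diracE inord_val.
Qed.

(** The integrand is a finite combination of indicators of the level sets of [sigma], whose
    measurability and probabilities are given. *)
Lemma expectation_uniform (R : realType) (d : measure_display) (Omega : measurableType d)
    (P : probability Omega R) n (A : {set 'S_n}) (sigma : Omega -> 'S_n) (g : 'S_n -> R) :
  uniform_random_perm P A sigma -> (forall t, 0 <= g t) ->
  ('E_P[fun w => g (sigma w)] = (#|A|%:R^-1 * \sum_(t in A) g t)%:E)%E.
Proof.
move=> us g0; rewrite unlock.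
have E w : (g (sigma w))%:E =
    (\sum_(t : 'S_n) (g t)%:E * (\1_(sigma @^-1` [set t]) w)%:E)%E.
  rewrite (bigD1 (sigma w))//= indicE mem_set// mule1 big1 ?adde0// => t tw.
  rewrite indicE memNset ?mule0// => /= e; by rewrite e eqxx in tw.
under eq_integral do rewrite E.
rewrite ge0_integral_sum//=; last 2 first.
- move=> t; apply: measurable_funeM; apply/measurable_EFinP.
  by apply: measurable_indic; have [] := us t.
- by move=> t w _; rewrite mule_ge0// lee_fin.
rewrite mulr_sumr -sumEFin [RHS]big_mkcond /=; apply: eq_bigr => t _.
have [mt Pt] := us t.
rewrite ge0_integralZl//=; last 2 first.
- by apply/measurable_EFinP; exact: measurable_indic.
- by rewrite lee_fin.
rewrite integral_indic// setIT.
transitivity ((g t)%:E * (if t \in A then #|A|%:R^-1 else 0)%:E)%E.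
  by congr (_ * _)%E.
by rewrite -EFinM; case: ifP => _; rewrite ?mulr0// mulrC.
Qed.

Section label_law.
Variables (R : realType) (d : measure_display) (Omega : measurableType d).
Variables (P : probability Omega R) (L : int -> {RV P >-> bool}).
Hypothesis iid : iid_fair_labels L.

Lemma iid_labels_window (h : nat) (a : seq bool) : size a = h.*2.+1 ->
  measurable [set w | forall k, (k < h.*2.+1)%N -> L (k%:Z - h%:Z) w = nth false a k] /\
  P [set w | forall k, (k < h.*2.+1)%N -> L (k%:Z - h%:Z) w = nth false a k] =
  (2 ^- h.*2.+1)%:E.
Proof.
move=> sa; have [ind fair] := iid.
pose r : seq int := [seq k%:Z - h%:Z | k <- iota 0 h.*2.+1].
pose B (x : int) : set bool := [set nth false a (absz (x + h%:Z))].
have -> : [set w | forall k, (k < h.*2.+1)%N -> L (k%:Z - h%:Z) w = nth false a k] =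
    \bigcap_(x in [set` r]) L x @^-1` B x.
  apply/seteqP; split=> [w H x /= /mapP[k]|w H k kh].
    rewrite mem_iota add0n => /andP[_ kh] ->; rewrite H// /B.
    by congr nth; lia.
  have /H : [set` r] (k%:Z - h%:Z) by apply/mapP; exists k; rewrite // mem_iota.
  by rewrite /B /= => ->; congr nth; lia.
split.
  apply: fin_bigcap_measurable => [|x _]; first exact: finite_seq.
  by rewrite -[X in measurable X]setTI; exact: measurable_funPT.
rewrite ind//; last first.
  by rewrite map_inj_uniq ?iota_uniq// => x y; lia.
under eq_bigr do rewrite fair.
rewrite big_const_seq count_predT size_map size_iota.
elim: (h.*2.+1) => [|k IH]; first by rewrite expr0 invr1.
by rewrite iterS IH -EFinM exprS invfM.
Qed.

(** The event is covered by the label words whose order lies in [U], each of probability 2 to the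
    minus 2 h + 1. Subadditivity gives the upper bound; passing to complements later turns it into
    equality. *)
Lemma random_order321_cylinder_le h (U : set (rooted_space R)) : cylinder h U ->
  (distribution P (random_order321 R L) U <=
   ((count (fun a => `[< U (rp321 (window_labels h a)) >]) (words h.*2.+1))%:R /
     2 ^+ h.*2.+1)%:E)%E.
Proof.
move=> cU; rewrite /distribution /pushforward.
pose W a := [set w | forall k, (k < h.*2.+1)%N -> L (k%:Z - h%:Z) w = nth false a k].
pose Q a := `[< U (rp321 (window_labels h a)) >].
have sub : random_order321 R L @^-1` U `<=`
    \big[setU/set0]_(a <- [seq a <- words h.*2.+1 | Q a]) W a.
  move=> w Uw; rewrite -bigcup_seq.
  exists (mkseq (fun k => L (k%:Z - h%:Z) w) h.*2.+1); last first.
    by move=> k kh; rewrite nth_mkseq.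
  rewrite /= mem_filter mem_words size_mkseq eqxx andbT; apply/asboolP.
  apply: cU Uw; apply/rp_restrP; split=> // x y hx hy.
  have e z : `|z| <= h%:Z ->
      window_labels h (mkseq (fun k => L (k%:Z - h%:Z) w) h.*2.+1) z = L z w.
    by move=> hz; rewrite /window_labels nth_mkseq; [congr (L _ w)|]; lia.
  by rewrite /= !le321E !e.
have mW a : a \in words h.*2.+1 -> measurable (W a).
  by rewrite mem_words => /eqP/iid_labels_window[].
have bound (r : seq (seq bool)) : {subset r <= words h.*2.+1} ->
   measurable (\big[setU/set0]_(a <- r) W a) /\
   (P (\big[setU/set0]_(a <- r) W a) <= ((size r)%:R / 2 ^+ h.*2.+1)%:E)%E.
  elim: r => [|a r IH] rw; first by rewrite big_nil measure0 mul0r; split.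
  have [mr Pr] := IH (fun x xr => rw x (mem_behead (s := a :: r) xr)).
  have aw := rw a (mem_head _ _); rewrite big_cons; split.
    by apply: measurableU => //; exact: mW.
  apply: le_trans (measureU2 _ (mW _ aw) mr) _.
  rewrite /= -natr1 addrC mulrDl mul1r EFinD; apply: leeD => //.
  by move: aw; rewrite mem_words => /eqP /iid_labels_window[_ <-].
have [mr Pr] := bound [seq a <- words h.*2.+1 | Q a]
  (fun x => ltac:(by rewrite mem_filter => /andP[])).
rewrite size_filter in Pr; apply: le_trans Pr; apply: le_measure; rewrite ?inE//.
rewrite -[X in measurable X]setTI; apply: measurable_random_order321 => //.
exact: cylinder_measurable cU.
Qed.

End label_law.

Theorem proposition5p26 (R : realType)
    (* uniform permutations sigma n of size n.+1 in Av(321) *)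
    (d : nat -> measure_display) (Omega : forall n, measurableType (d n))
    (P : forall n, probability (Omega n) R)
    (sigma : forall n, Omega n -> 'S_n.+1)
    (* the random infinite rooted permutation sigma^infty_321 *)
    (dX : measure_display) (OmegaX : measurableType dX)
    (PX : probability OmegaX R) (X : {RV PX >-> rooted_space R})
    (* the labels of the construction *)
    (dL : measure_display) (OmegaL : measurableType dL)
    (PL : probability OmegaL R) (L : int -> {RV PL >-> bool}) :
  (forall n, uniform_random_perm (P n) (Av321 n.+1) (sigma n)) ->
  (forall w, infinite_set (rp_dom (X w))) ->
  quenched_BS_cvg P sigma (distribution PX X) ->
  iid_fair_labels L ->
  forall B : set (rooted_space R), measurable B ->
    distribution PL (random_order321 R L) B = distribution PX X B.
Proof.
move=> us _ qc iid.
have le h (U : set (rooted_space R)) : cylinder h U ->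
    (distribution PL (random_order321 R L) U <= distribution PX X U)%E.
  move=> cU; apply: le_trans (random_order321_cylinder_le iid cU) _.
  have mU := cylinder_measurable cU.
  have bounded : exists M, forall nu : pmeasure R, `|mass U nu| <= M.
    exists 1 => nu; rewrite /mass ger0_norm ?fine_ge0//.
    by rewrite -lee_fin fineK ?fin_num_measure//; exact: probability_le1.
  have -> : distribution PX X U = (mass U (distribution PX X))%:E.
    by rewrite /mass fineK// fin_num_measure.
  (* The mass of a cylinder is an admissible test functional, so its mean converges to the mass
     under the limit law. *)
  have c1 := qc _ (mass_continuous cU) bounded.
  pose Q a := `[< U (rp321 (window_labels h a)) >].
  pose fr n : R := freq R n (fun i s => high (8 * h).+1 i s && Q (labels h.*2.+1 i s)).
  have c2 : (fr n.+1)%:E @[n --> \oo] -->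
      ((count Q (words h.*2.+1))%:R / 2 ^+ h.*2.+1)%:E.
    apply/fine_cvgP; split; first exact: nearW.
    by rewrite (cvg_shiftS fr); exact: freq_high_labels.
  apply: lee_cvg_to c2 c1 _; apply: nearW => n.
  have m0 (t : 'S_n.+1) : 0 <= mass U (mu_perm R t : pmeasure R) by rewrite /mass fine_ge0.
  rewrite /= (expectation_uniform (us n) m0).
  rewrite lee_fin; apply: le_trans (freq_le_root_mass R n cU) _.
  rewrite ler_wpM2l ?invr_ge0//; apply: ler_sum => t _.
  by rewrite mass_mu_perm.
apply: probability_eq_cylinder => h U cU.
have mU := cylinder_measurable cU.
apply/eqP; rewrite eq_le (le h)//=.
(* For the complement, the same inequality is the reverse inequality for [U]. *)
have := le h _ (cylinderC cU).
by rewrite !probability_setC// leeD2lE// leeN2.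
Qed.
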